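(* Let $(V_*,\{K_\alpha\}_{\alpha\in\mathcal A},\{(V_\alpha,E_\alpha,r_\alpha)\}_{\alpha\in\mathcal A})$ be a harmonic finitely ramified cell structure with filtration $\{\mathcal A_n\}_{n\ge0}$ and associated resistance form $(\mathcal E,\mathcal F)$ on $V_*$, let $\{\widetilde{\mathcal A}_n\}_{n\ge 0}$ be subsets as in Assumption (A1) of the context, and assume that (A2) holds. Let $(\widetilde{\mathcal E},\widetilde{\mathcal F})$ be the associated form defined in the context. Then the following statements are equivalent: (1) $(\mathcal E,\mathcal F)=(\widetilde{\mathcal E},\widetilde{\mathcal F})$; (2) $(\mathcal E|_{V_n},\ell(V_n))=(\widetilde{\mathcal E}|_{V_n},\ell(V_n))$ for any $n\ge0$ (equality of traces); (3) $(\mathcal E_{K_\alpha},\mathcal F_{K_\alpha})=(\widetilde{\mathcal E}_{\alpha},\widetilde{\mathcal F}_{\alpha})$ for all $\alpha\in\mathcal A$; (4) $R_\alpha(x,y)=\widetilde R_\alpha(x,y)$ for any $\alpha\in\mathcal A$ and any $x,y\in V_\alpha$; (5) $R_{\mathcal E}(x,y)=\widetilde R(x,y)$ for any $x,y\in V_*$.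
   Context: **Resistance forms.** A resistance form on a set $X$ is a pair $(\mathcal E,\mathcal F)$ such that: (RF1) $\mathcal F$ is a linear space of real functions on $X$ containing constants, $\mathcal E$ is a non-negative symmetric quadratic form on $\mathcal F$, and $\mathcal E(u,u)=0$ iff $u$ is constant; (RF2) $\mathcal F$ modulo constants with $\mathcal E$ is a Hilbert space; (RF3) $\mathcal F$ separates points; (RF4) $R_{\mathcal E}(x,y)=\sup\{|u(x)-u(y)|^2/\mathcal E(u,u): u\in\mathcal F,\ \mathcal E(u,u)>0\}<\infty$; (RF5) for $u\in\mathcal F$, $\bar u=\min\{\max\{0,u\},1\}\in\mathcal F$ and $\mathcal E(\bar u,\bar u)\le\mathcal E(u,u)$. $R_{\mathcal E}$ is the associated resistance metric. For non-empty $Y\subseteq X$ the trace $(\mathcal E|_Y,\mathcal F|_Y)$ is $\mathcal F|_Y=\{u|_Y:u\in\mathcal F\}$, $\mathcal E|_Y(u,u)=\min\{\mathcal E(v,v):v\in\mathcal F,v|_Y=u\}$. For a set $V$, $\ell(V)$ denotes all real functions on $V$. **Finitely ramified cell structure.** A countable set $V_*$ with an index set $\mathcal A$, a family $\{K_\alpha\}_{\alpha\in\mathcal A}$ and weighted graphs $\{(V_\alpha,E_\alpha,r_\alpha)\}_{\alpha\in\mathcal A}$ such that: (a) $\mathcal A$ is countable; (b) the $K_\alpha$ are distinct countable subsets of $V_*$; (c) each $V_\alpha\subsetneq K_\alpha$ is finite with at least two elements; (d) for $x,y\in V_\alpha$, $\{x,y\}\in E_\alpha$ iff $0<r_\alpha(x,y)<\infty$;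 (e) if $K_\alpha=\bigcup_{i=1}^kK_{\alpha_i}$ then $V_\alpha\subseteq\bigcup_{i=1}^kV_{\alpha_i}$; (f) there is a filtration $\{\mathcal A_n\}_{n\ge0}$ of finite pairwise disjoint subsets of $\mathcal A$, with $\mathcal A_0=\{\emptyset\}$, $K_\emptyset=V_*$, such that for any $\alpha\in\mathcal A_n$ there are $\alpha_1,\dots,\alpha_k\in\mathcal A_{n+1}$ with $K_\alpha=\bigcup_{i=1}^kK_{\alpha_i}$; (g) $K_\alpha\cap K_{\alpha'}=V_\alpha\cap V_{\alpha'}$ for distinct $\alpha,\alpha'$ (in the same $\mathcal A_n$); (h) for any strictly decreasing infinite cell sequence $K_{\alpha_1}\supsetneq K_{\alpha_2}\supsetneq\cdots$ there is $x\in V_*$ with $\bigcap_nK_{\alpha_n}=\{x\}$. Here $\mathcal A=\bigcup_n\mathcal A_n$. Put $V_n=\bigcup_{\alpha\in\mathcal A_n}V_\alpha$; $V_*=\bigcup_nV_n$. **Energies.** $\mathcal E_\alpha(u,v)=\sum_{\{x,y\}\in E_\alpha}r_\alpha(x,y)^{-1}(u(x)-u(y))(v(x)-v(y))$ for $u,v\in\ell(V_\alpha)$ and $\mathcal E_n(u,v)=\sum_{\alpha\in\mathcal A_n}\mathcal E_\alpha(u|_{V_\alpha},v|_{V_\alpha})$ for $u,v\in\ell(V_n)$. The structure is harmonic if $(\mathcal E_n,\ell(V_n))$ are resistance forms forming a compatible sequence, i.e. $\mathcal E_n$ is the trace of $\mathcal E_{n+1}$ on $V_n$ for every $n$. It then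 defines the resistance form $\mathcal E(u,v)=\lim_n\mathcal E_n(u|_{V_n},v|_{V_n})$, $\mathcal F=\{u\colon V_*\to\mathbb R:\mathcal E(u,u)<\infty\}$ on $V_*$. **Restriction to cells.** For $\alpha\in\mathcal A_m$, the restriction of $(\mathcal E,\mathcal F)$ to $K_\alpha$ is $\mathcal E_{K_\alpha}(u,u)=\lim_{n\to\infty}\sum_{\alpha'\in\mathcal A_n,\,K_{\alpha'}\subseteq K_\alpha}\mathcal E_{\alpha'}(u|_{V_{\alpha'}},u|_{V_{\alpha'}})$, $\mathcal F_{K_\alpha}=\{u\colon K_\alpha\to\mathbb R:\mathcal E_{K_\alpha}(u,u)<\infty\}$; it is a resistance form on $K_\alpha$ with $\mathcal E_{K_\alpha}|_{V_\alpha}=\mathcal E_\alpha$. Its resistance metric is $R_\alpha$. **Assumption (A1).** For each $n\ge0$ there is $\widetilde{\mathcal A}_n\subseteq\mathcal A_n$ such that for any $\alpha\in\widetilde{\mathcal A}_{n+1}$, $K_\alpha\subseteq K_{\alpha'}$ for some $\alpha'\in\widetilde{\mathcal A}_n$, and the set $\mathcal C=\bigcap_{n\ge0}\bigcup_{\alpha\in\widetilde{\mathcal A}_n}K_\alpha$ is non-empty. **Assumption (A2).** The closure (completion) of $V_*$ with respect to $R_{\mathcal E}$ is compact. **The form $\widetilde{\mathcal E}$.** $\widetilde{\mathcal F}_n=\{u\in\mathcal F:u|_{K_\alpha}\text{ is constant for all }\alpha\in\widetilde{\mathcal A}_n\}$; $\widetilde{\mathcal F}$ is the set of $u\in\mathcal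 F$ for which there is $\{u_n\}\subseteq\bigcup_{n\ge1}\widetilde{\mathcal F}_n$ with $\mathcal E(u-u_n,u-u_n)\to0$ and $u_n(x)\to u(x)$ for all $x\in V_*$; $\widetilde{\mathcal E}=\mathcal E|_{\widetilde{\mathcal F}\times\widetilde{\mathcal F}}$. Standing fact: $(\widetilde{\mathcal E},\widetilde{\mathcal F})$ is a resistance form on $V_*$. Its restriction to $K_\alpha$ is $\widetilde{\mathcal F}_\alpha=\{u|_{K_\alpha}:u\in\widetilde{\mathcal F}\}$ with $\widetilde{\mathcal E}_\alpha=\mathcal E_{K_\alpha}|_{\widetilde{\mathcal F}_\alpha\times\widetilde{\mathcal F}_\alpha}$, and $\widetilde R_\alpha$ is its resistance metric, $\widetilde R_\alpha(x,y)=\sup\{|u(x)-u(y)|^2/\widetilde{\mathcal E}_\alpha(u,u):u\in\widetilde{\mathcal F}_\alpha,\widetilde{\mathcal E}_\alpha(u,u)>0\}$. Finally $\widetilde R_n(x,y)=\sup\{|u(x)-u(y)|^2/\mathcal E(u,u):u\in\widetilde{\mathcal F}_n,\ \mathcal E(u,u)\ne0\}$ and $\widetilde R(x,y)=\lim_{n\to\infty}\widetilde R_n(x,y)$ for $x,y\in V_*$.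
   Formalization: Axiom (h) as written (the intersection of a strictly decreasing cell sequence equals {x} for some x in the countable set V_* ) contradicts the other axioms; it is replaced by the weaker requirement that the intersection be contained in {x} for some x in V_*. *)

(* Defs.v *)
From HB Require Import structures.
From mathcomp Require Import all_boot all_order all_algebra.
From mathcomp Require Import all_classical all_reals all_analysis.

Set Implicit Arguments.
Unset Strict Implicit.
Unset Printing Implicit Defensive.

Import Order.TTheory GRing.Theory Num.Theory.
Import numFieldNormedType.Exports.

Local Open Scope classical_set_scope.
Local Open Scope ring_scope.

(* A quadratic form with its domain; only the values of [en] on [dom] are
   meaningful, so two forms are compared with [eq_form] instead of [=]. *)
Record qform (R : realType) (X : Type) := QForm {
  dom : set (X -> R) ;
  en : (X -> R) -> (X -> R) -> R }.

Definition eq_form (R : realType) (X : Type) (f g : qform R X) : Prop :=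
  dom f = dom g /\
  forall u v, dom f u -> dom f v -> en f u v = en g u v.

Definition subform (R : realType) (X : Type) (f : qform R X)
    (D : set (X -> R)) : qform R X := QForm D (en f).

(* The supremum over an empty set of functions is 0, hence the [maxe 0]. *)
Definition resistance (R : realType) (X : Type) (f : qform R X) (x y : X)
    : \bar R :=
  maxe 0%E (ereal_sup [set ((`|u x - u y| ^+ 2 / en f u u)%:E)
                      | u in [set u | dom f u /\ 0 < en f u u]]).

Record resistance_form (R : realType) (X : Type) (f : qform R X) : Prop := {
  rf1_const : forall c : R, dom f (fun=> c) ;
  rf1_lin : forall (a : R) (u v : X -> R),
    dom f u -> dom f v -> dom f (fun x => a * u x + v x) ;
  rf1_sym : forall u v, dom f u -> dom f v -> en f u v = en f v u ;
  rf1_bilin : forall (a : R) (u v w : X -> R), dom f u -> dom f v -> dom f w ->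
    en f (fun x => a * u x + v x) w = a * en f u w + en f v w ;
  rf1_ge0 : forall u, dom f u -> 0 <= en f u u ;
  rf1_eq0 : forall u, dom f u -> (en f u u = 0 <-> exists c, u = fun=> c) ;
  (* completeness of [dom f] modulo constants for the inner product [en f] *)
  rf2 : forall u : nat -> X -> R, (forall n, dom f (u n)) ->
    (forall e : R, 0 < e -> exists N : nat, forall m n : nat,
       (N <= m)%N -> (N <= n)%N -> en f (u m \- u n) (u m \- u n) < e) ->
    exists2 v, dom f v & en f (u n \- v) (u n \- v) @[n --> \oo] --> (0 : R) ;
  rf3 : forall x y : X, x <> y -> exists2 u, dom f u & u x <> u y ;
  rf4 : forall x y : X, (resistance f x y < +oo)%E ;
  rf5 : forall u, dom f u ->
    let u' := fun x => Num.min (Num.max 0 (u x)) 1 in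
    dom f u' /\ en f u' u' <= en f u u }.

(* The minimum of a set of reals; a junk value if there is none. *)
Definition set_min (R : realType) (S : set R) : R := get (S `&` lbound S).

(* Trace along a restriction map [rho]. The bilinear form is obtained by
   polarization from the quadratic form that is defined by the minimum. *)
Definition trace_energy (R : realType) (X Y : Type)
    (rho : (X -> R) -> (Y -> R)) (f : qform R X) (u : Y -> R) : R :=
  set_min [set en f v v | v in [set v | dom f v /\ rho v = u]].

Definition trace_form (R : realType) (X Y : Type) (rho : (X -> R) -> (Y -> R))
    (f : qform R X) : qform R Y :=
  QForm (rho @` dom f)
    (fun u v => (trace_energy rho f (u \+ v) - trace_energy rho f (u \- v)) / 4).

(* Restriction to A of a function defined on B, meant for A included in B. *)
Definition restr (R : realType) (T : Type) (B A : set T) (u : B -> R) : A -> R :=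
  sigL A ('valL_ 0 u).
Arguments restr {R T B} A u _ : rename.

Record cell_structure (R : realType) (T A : choiceType) := CellStructure {
  K_ : A -> set T ;
  V_ : A -> set T ;
  (* an unordered edge {x, y} is encoded by the two pairs (x, y) and (y, x) *)
  edge : forall a, set (V_ a * V_ a)%type ;
  r_ : forall a, V_ a -> V_ a -> \bar R ;
  filt : nat -> set A ;
  root : A }.
Arguments edge {R T A} c a.
Arguments r_ {R T A} c a.

(* The ambient type T is V_*.

   [frc_h] only asks that the intersection of a strictly decreasing sequence of
   cells have at most one point of V_*. Asking for exactly one point
   of V_* would be contradictory: a cell K_a and a point x being given, take y in
   K_a other than x; by finiteness of the levels (Koenig), some level has no cell
   containing both x and y, so K_a has a subcell that avoids x. Iterating over an
   enumeration of the countable set V_* gives a strictly decreasing sequence of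
   cells with empty intersection (in the unit interval with dyadic cells: any
   sequence of cells that shrinks to a non-dyadic point). The condition below
   follows both from the literal one and from the one where closures in the
   completion of V_* are intersected. *)
Record finitely_ramified (R : realType) (T A : choiceType)
    (S : cell_structure R T A) : Prop := {
  frc_countable : countable [set: T] ;
  frc_a : countable [set: A] ;
  frc_b : forall a, countable (K_ S a) ;
  frc_b_inj : injective (K_ S) ;
  frc_c_sub : forall a, V_ S a `<` K_ S a ;
  frc_c_fin : forall a, finite_set (V_ S a) ;
  frc_c_two : forall a, exists x y, [/\ V_ S a x, V_ S a y & x <> y] ;
  frc_r_ge0 : forall a x y, (0 <= r_ S a x y)%E ;
  frc_r_sym : forall a x y, r_ S a x y = r_ S a y x ;
  frc_d : forall a x y, edge S a (x, y) <-> (0 < r_ S a x y < +oo)%E ;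
  frc_e : forall a (B : set A), finite_set B ->
    K_ S a = \bigcup_(b in B) K_ S b -> V_ S a `<=` \bigcup_(b in B) V_ S b ;
  frc_f_cover : \bigcup_n filt S n = [set: A] ;
  frc_f_fin : forall n, finite_set (filt S n) ;
  frc_f_disj : trivIset [set: nat] (filt S) ;
  frc_f0 : filt S 0%N = [set root S] ;
  frc_f_root : K_ S (root S) = [set: T] ;
  frc_f_sub : forall n a, filt S n a -> exists2 B : set A,
    B `<=` filt S n.+1 & K_ S a = \bigcup_(b in B) K_ S b ;
  frc_g : forall n a b, filt S n a -> filt S n b -> a <> b ->
    K_ S a `&` K_ S b = V_ S a `&` V_ S b ;
  frc_h : forall s : nat -> A, (forall n, K_ S (s n.+1) `<` K_ S (s n)) ->
    exists x : T, \bigcap_n K_ S (s n) `<=` [set x] ;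
  frc_vertices : \bigcup_n (\bigcup_(a in filt S n) V_ S a) = [set: T] }.

Section Energies.
Variables (R : realType) (T A : choiceType) (S : cell_structure R T A).

Definition Vn (n : nat) : set T := \bigcup_(a in filt S n) V_ S a.

Definition Ecell (a : A) (u v : V_ S a -> R) : R :=
  2^-1 * \sum_(p \in edge S a)
    (fine (r_ S a p.1 p.2))^-1 * (u p.1 - u p.2) * (v p.1 - v p.2).

Definition En (n : nat) (u v : Vn n -> R) : R :=
  \sum_(a \in filt S n) Ecell (restr (V_ S a) u) (restr (V_ S a) v).

Definition En_form (n : nat) : qform R (Vn n) := QForm setT (@En n).

Definition harmonic_structure : Prop :=
  (forall n, resistance_form (En_form n)) /\
  (forall n, eq_form (En_form n)
               (trace_form (restr (Vn n)) (En_form n.+1))).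

Definition E_form : qform R T := QForm
  [set u | (limn (fun n => (En (sigL (Vn n) u) (sigL (Vn n) u))%:E) < +oo)%E]
  (fun u v => limn (fun n => En (sigL (Vn n) u) (sigL (Vn n) v))).

Definition EKn (a : A) (n : nat) (u v : K_ S a -> R) : R :=
  \sum_(b \in [set b | filt S n b /\ K_ S b `<=` K_ S a])
    Ecell (restr (V_ S b) u) (restr (V_ S b) v).

Definition EK_form (a : A) : qform R (K_ S a) := QForm
  [set u | (limn (fun n => (EKn n u u)%:E) < +oo)%E]
  (fun u v => limn (fun n => EKn n u v)).

Definition assumption_A1 (At : nat -> set A) : Prop :=
  [/\ forall n, At n `<=` filt S n,
      forall n a, At n.+1 a -> exists2 b, At n b & K_ S a `<=` K_ S b &
      \bigcap_n (\bigcup_(a in At n) K_ S a) !=set0].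

Definition is_completion (X : metricType R) (i : T -> X)
    (d : T -> T -> \bar R) : Prop :=
  [/\ forall x y, (mdist (i x) (i y))%:E = d x y,
      dense (range i) &
      forall F : set_system X, ProperFilter F -> cauchy F -> exists p : X, F --> p].

Definition assumption_A2 : Prop :=
  exists (X : metricType R) (i : T -> X),
    is_completion i (resistance E_form) /\ compact [set: X].

Variable At : nat -> set A.

Definition Ftilde_n (n : nat) : set (T -> R) :=
  [set u | dom E_form u /\
     forall a, At n a -> forall x y, K_ S a x -> K_ S a y -> u x = u y].

Definition Ftilde : set (T -> R) :=
  [set u | dom E_form u /\ exists u_ : nat -> T -> R,
     [/\ forall k, (\bigcup_(n in [set n | (1 <= n)%N]) Ftilde_n n) (u_ k),
         en E_form (u \- u_ k) (u \- u_ k) @[k --> \oo] --> (0 : R) &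
         forall x, u_ k x @[k --> \oo] --> u x]].

Definition Etilde_form : qform R T := subform E_form Ftilde.

Definition EKtilde_form (a : A) : qform R (K_ S a) :=
  subform (EK_form a) (sigL (K_ S a) @` Ftilde).

Definition Rtilde_n (n : nat) : T -> T -> \bar R :=
  resistance (subform E_form (Ftilde_n n)).

Definition Rtilde (x y : T) : \bar R := limn (fun n => Rtilde_n n x y).

End Energies.

(* Main.v *)
Require Import Defs.
From HB Require Import structures.
From mathcomp Require Import all_boot all_order all_algebra finmap.
From mathcomp Require Import all_classical all_reals all_analysis.
From mathcomp Require Import ring lra.

Set Implicit Arguments.
Unset Strict Implicit.
Unset Printing Implicit Defensive.

Import Order.TTheory GRing.Theory Num.Theory.
Import numFieldNormedType.Exports.

Local Open Scope classical_set_scope.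
Local Open Scope ring_scope.

(** Since the second form is a restriction of the first one, (1) says that the
    two domains coincide, i.e. that functions that are constant on the marked
    cells of some level ([flat] functions) are dense in energy. Then (2), (3),
    (4) and (5) follow: traces and resistances depend only on the form, dense
    subspaces give the same resistances, and a function with finite energy in a
    cell extends to the whole space ([cell_extension]).

    In the other direction, density is reduced in [nearly_extremal_dense] to a
    finite-dimensional statement, [nearly_extremal]: for all u of finite energy
    and all n some w in the small domain has the values of u on [Vn n] and
    energy at most E(u) + e. Indeed E(u + w) is at least 4 E_n(u), so the
    parallelogram identity bounds E(u - w) by 4 (E(u) - E_n(u)) + 2 e.

    Equality of traces gives such a w as a minimizer, as the small domain is
    complete. Equality of resistances gives it by [interpolation], a statement
    on a quadratic form with the Markov property and a subspace W with the same
    resistances between the points of a finite set. Subtracting from u its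
    near-projection on W leaves a function h that is nearly orthogonal to W.
    Where W attains the resistance r between x and y, the Cauchy-Schwarz
    inequality for r E(u, v) - (u x - u y) (v x - v y) forces h x and h y to be
    nearly equal. For (5) this is applied on [Vn n] in the whole space, for (4)
    on [V a] inside each cell a of level n, and the functions obtained in the
    cells are glued.

    Two points need care. Inside a cell the form may be disconnected, so that
    resistances are infinite: there W contains separating functions of
    arbitrarily small energy, built from minima, and these take over. And
    harmonicity of the whole sequence does not make the energies inside a cell
    increase at all levels, because cells with several common vertices may
    exchange energy. But strictly decreasing sequences of cells have at most one
    common point, so from some level on no cell contains two vertices of a given
    cell a, and then the excess of energy inside a is a diagonal quadratic form
    on [V a] that is invariant under adding constants, hence zero ([excess_cell_eq0], [sub_en_mono]). *)

(** * Non-negative quadratic forms on spaces of functions *)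

Section PointwiseOperations.
Variables (R : realType) (X : Type).
Implicit Types u v : X -> R.

Lemma addfE u v x : (u + v) x = u x + v x. Proof. by []. Qed.

Lemma oppfE u x : (- u) x = - u x. Proof. by []. Qed.

Lemma scalefE (a : R) u x : (a *: u) x = a * u x. Proof. by []. Qed.

Definition funE := (addfE, oppfE, scalefE).

End PointwiseOperations.

Lemma cvg_close (R : realType) (u : nat -> R) (l e : R) :
  u k @[k --> \oo] --> l -> 0 < e ->
  exists N, forall k, (N <= k)%N -> `|l - u k| <= e.
Proof.
by move=> /cvgrPdist_le ul e0; have [N _ hN] := ul e e0; exists N.
Qed.

Lemma cvg0_le (R : realType) (u : nat -> R) (e : R) :
  u k @[k --> \oo] --> (0 : R) -> 0 < e ->
  exists N, forall k, (N <= k)%N -> u k <= e.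
Proof.
move=> u0 e0; have [N hN] := cvg_close u0 e0; exists N => k Nk.
by have := hN k Nk; rewrite sub0r normrN; exact: le_trans (ler_norm _).
Qed.

Lemma quadratic_discr (R : realType) (a b c : R) : 0 <= c ->
  (forall t : R, 0 <= a + 2 * t * b + t ^+ 2 * c) -> b ^+ 2 <= a * c.
Proof.
move=> c0 H; have [c1|c1] := ltP 0 c; last first.
  have cE : c = 0 by apply/eqP; rewrite eq_le c0 c1.
  have [->|bn0] := eqVneq b 0; first by rewrite cE expr0n mulr0.
  have := H (- (a + 1) / (2 * b)).
  rewrite cE mulr0 addr0.
  have -> : a + 2 * (- (a + 1) / (2 * b)) * b = - 1 by field.
  by rewrite ler0N1.
have := H (- b / c).
have -> : a + 2 * (- b / c) * b + (- b / c) ^+ 2 * c = (a * c - b ^+ 2) / c.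
  by field; rewrite gt_eqF.
by rewrite pmulr_lge0 ?invr_gt0// subr_ge0.
Qed.

(** Only the linear part of the axioms of a resistance form, without the
    condition on the kernel: the restriction of a form to a cell need not be
    connected, and then non-constant functions may have zero energy. *)
Record psd_form (R : realType) (X : Type) (f : qform R X) : Prop := {
  psd_cst : forall c : R, dom f (fun=> c) ;
  psd_lin : forall (a : R) (u v : X -> R),
    dom f u -> dom f v -> dom f (a *: u + v) ;
  psd_sym : forall u v, dom f u -> dom f v -> en f u v = en f v u ;
  psd_bilin : forall (a : R) (u v w : X -> R), dom f u -> dom f v -> dom f w ->
    en f (a *: u + v) w = a * en f u w + en f v w ;
  psd_ge0 : forall u, dom f u -> 0 <= en f u u ;
  psd_cst0 : forall c : R, en f (fun=> c) (fun=> c) = 0 }.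

Section PsdForm.
Variables (R : realType) (X : Type) (f : qform R X).
Hypothesis psdf : psd_form f.
Implicit Types (u v w : X -> R) (a c t : R).
Local Notation Q u := (en f u u).

Lemma dom0 : dom f 0.
Proof. exact: (psd_cst psdf 0). Qed.

Lemma domZ a u : dom f u -> dom f (a *: u).
Proof. by move=> fu; rewrite -[_ *: _]addr0; apply: psd_lin => //; exact: dom0. Qed.

Lemma domD u v : dom f u -> dom f v -> dom f (u + v).
Proof. by move=> fu fv; rewrite -[u]scale1r; exact: psd_lin. Qed.

Lemma domN u : dom f u -> dom f (- u).
Proof. by move=> fu; rewrite -scaleN1r; exact: domZ. Qed.

Lemma domB u v : dom f u -> dom f v -> dom f (u - v).
Proof. by move=> fu fv; apply: domD => //; exact: domN. Qed.

Lemma en0l w : dom f w -> en f 0 w = 0.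
Proof.
move=> fw; have := psd_bilin psdf 1 dom0 dom0 fw.
rewrite scaler0 addr0 mul1r => /eqP.
by rewrite -subr_eq0 opprD addNKr oppr_eq0 => /eqP.
Qed.

Lemma enZl a u w : dom f u -> dom f w -> en f (a *: u) w = a * en f u w.
Proof.
move=> fu fw; rewrite -[a *: u]addr0 psd_bilin// ?en0l ?addr0//; exact: dom0.
Qed.

Lemma enDl u v w : dom f u -> dom f v -> dom f w ->
  en f (u + v) w = en f u w + en f v w.
Proof. by move=> fu fv fw; rewrite -{1}[u]scale1r psd_bilin// mul1r. Qed.

Lemma enZr a u w : dom f u -> dom f w -> en f w (a *: u) = a * en f w u.
Proof. by move=> fu fw; rewrite psd_sym ?enZl// 1?psd_sym//; exact: domZ. Qed.

Lemma enDr u v w : dom f u -> dom f v -> dom f w ->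
  en f w (u + v) = en f w u + en f w v.
Proof.
move=> fu fv fw; rewrite psd_sym ?enDl// 1?(psd_sym psdf fu)// 1?(psd_sym psdf fv)//.
exact: domD.
Qed.

Lemma en_scale a u : dom f u -> Q (a *: u) = a ^+ 2 * Q u.
Proof. by move=> fu; rewrite enZl ?enZr// ?mulrA ?expr2//; exact: domZ. Qed.

Lemma en_opp u : dom f u -> Q (- u) = Q u.
Proof. by move=> fu; rewrite -scaleN1r en_scale// sqrrN expr1n mul1r. Qed.

Lemma en_expand t u v : dom f u -> dom f v ->
  Q (u + t *: v) = Q u + 2 * t * en f u v + t ^+ 2 * Q v.
Proof.
move=> fu fv; have ftv := domZ t fv; have fuv := domD fu ftv.
rewrite enDl// !enDr// !enZr// !enZl// (psd_sym psdf fv fu); ring.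
Qed.

Lemma en_add u v : dom f u -> dom f v -> Q (u + v) = Q u + 2 * en f u v + Q v.
Proof.
by move=> fu fv; have := en_expand 1 fu fv; rewrite scale1r expr1n mulr1 mul1r.
Qed.

Lemma en_sub u v : dom f u -> dom f v -> Q (u - v) = Q u - 2 * en f u v + Q v.
Proof.
move=> fu fv; have := en_expand (- 1) fu fv.
by rewrite scaleN1r => ->; ring.
Qed.

Lemma parallelogram u v : dom f u -> dom f v ->
  Q (u - v) = 2 * Q u + 2 * Q v - Q (u + v).
Proof. by move=> fu fv; rewrite en_sub// en_add//; ring. Qed.

Lemma en_subC u v : dom f u -> dom f v -> Q (u - v) = Q (v - u).
Proof. by move=> fu fv; rewrite -opprB en_opp//; exact: domB. Qed.

Lemma cauchy_schwarz u v : dom f u -> dom f v -> en f u v ^+ 2 <= Q u * Q v.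
Proof.
move=> fu fv; apply: quadratic_discr; first exact: psd_ge0.
move=> t; rewrite -en_expand//; apply: psd_ge0 => //.
by apply: domD => //; exact: domZ.
Qed.

Lemma en_cst c v : dom f v -> en f v (fun=> c) = 0.
Proof.
move=> fv; have /= := cauchy_schwarz fv (psd_cst psdf c).
by rewrite psd_cst0// mulr0 => h; apply/eqP; rewrite -sqrf_eq0 eq_le h sqr_ge0.
Qed.

Lemma en_addcst u c : dom f u -> Q (u + (fun=> c)) = Q u.
Proof.
move=> fu; rewrite en_add// ?psd_cst0// ?en_cst// ?mulr0 ?addr0//.
exact: psd_cst.
Qed.

Lemma en_add_le2 u v : dom f u -> dom f v -> Q (u + v) <= 2 * Q u + 2 * Q v.
Proof.
move=> fu fv; have := psd_ge0 psdf (domB fu fv).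
by rewrite parallelogram// subr_ge0.
Qed.

Definition enorm u := Num.sqrt (Q u).

Lemma enorm_ge0 u : 0 <= enorm u.
Proof. exact: sqrtr_ge0. Qed.

Lemma sqr_enorm u : dom f u -> enorm u ^+ 2 = Q u.
Proof. by move=> fu; rewrite sqr_sqrtr//; exact: psd_ge0. Qed.

Lemma abs_en_le u v : dom f u -> dom f v -> `|en f u v| <= enorm u * enorm v.
Proof.
move=> fu fv; rewrite -ler_sqr ?nnegrE ?mulr_ge0 ?sqrtr_ge0//.
by rewrite real_normK ?num_real// exprMn !sqr_enorm//; exact: cauchy_schwarz.
Qed.

Lemma enormD u v : dom f u -> dom f v -> enorm (u + v) <= enorm u + enorm v.
Proof.
move=> fu fv; rewrite -ler_sqr ?nnegrE ?addr_ge0 ?sqrtr_ge0//.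
rewrite (sqr_enorm (domD fu fv)) en_add// sqrrD !sqr_enorm//.
have := le_trans (ler_norm _) (abs_en_le fu fv).
by rewrite -mulr_natl; lra.
Qed.

Lemma enormZ a u : dom f u -> enorm (a *: u) = `|a| * enorm u.
Proof.
by move=> fu; rewrite /enorm en_scale// sqrtrM ?sqr_ge0// sqrtr_sqr.
Qed.

Lemma enorm_subC u v : dom f u -> dom f v -> enorm (u - v) = enorm (v - u).
Proof. by move=> fu fv; rewrite /enorm en_subC. Qed.

Lemma enorm_dist u v : dom f u -> dom f v ->
  `|enorm u - enorm v| <= enorm (u - v).
Proof.
move=> fu fv; rewrite ler_norml; apply/andP; split.
  rewrite lerNl opprB lerBlDr enorm_subC//.
  by rewrite -{1}(subrK u v) enormD//; exact: domB.
by rewrite lerBlDr -{1}(subrK v u) enormD//; exact: domB.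
Qed.

Lemma enorm_cvg (v : X -> R) (w : nat -> X -> R) : dom f v ->
    (forall k, dom f (w k)) ->
  Q (w k - v) @[k --> \oo] --> (0 : R) -> enorm (w k) @[k --> \oo] --> enorm v.
Proof.
move=> fv fw wv; apply/cvgrPdist_le => e e0.
have e20 : 0 < e ^+ 2 by rewrite exprn_gt0.
move/cvgrPdist_le : wv => /(_ _ e20); apply: filterS => k.
rewrite sub0r normrN ger0_norm ?psd_ge0//; last exact: domB.
move=> h; rewrite (le_trans (enorm_dist _ _))// enorm_subC//.
by rewrite -ler_sqr ?nnegrE ?sqrtr_ge0 ?(ltW e0)// sqr_enorm//; exact: domB.
Qed.

Lemma en_cvg (v : X -> R) (w : nat -> X -> R) : dom f v ->
    (forall k, dom f (w k)) ->
  Q (w k - v) @[k --> \oo] --> (0 : R) -> Q (w k) @[k --> \oo] --> Q v.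
Proof.
move=> fv fw wv; have h := enorm_cvg fv fw wv.
rewrite -(sqr_enorm fv) expr2.
under eq_fun => k do rewrite -(sqr_enorm (fw k)) expr2.
exact: cvgM.
Qed.

End PsdForm.

(** * Minimal extensions and traces *)

Definition complete_form (R : realType) (X : Type) (f : qform R X) : Prop :=
  forall u : nat -> X -> R, (forall n, dom f (u n)) ->
    (forall e : R, 0 < e -> exists N : nat, forall m n : nat,
       (N <= m)%N -> (N <= n)%N -> en f (u m - u n) (u m - u n) < e) ->
    exists2 v, dom f v & en f (u n - v) (u n - v) @[n --> \oo] --> (0 : R).

(** Finiteness of resistances, in a form that moreover makes functions without
    energy constant. *)
Definition point_bounded (R : realType) (X : Type) (f : qform R X) : Prop :=
  forall x y : X, exists C : R, forall u, dom f u ->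
    (u x - u y) ^+ 2 <= C * en f u u.

(** By the parallelogram identity a minimizing sequence is Cauchy. Its limit is
    known up to a constant, which the value at [y0] fixes; the increments then
    converge as well, so that the constraint passes to the limit. *)
Lemma min_extension (R : realType) (X Y : Type) (j : Y -> X) (y0 : Y)
    (f : qform R X) (u0 : X -> R) :
  psd_form f -> complete_form f -> point_bounded f -> dom f u0 ->
  exists v, [/\ dom f v, v \o j = u0 \o j &
    forall w, dom f w -> w \o j = u0 \o j -> en f v v <= en f w w].
Proof.
move=> pf cf bf fu0.
pose S := [set en f w w | w in [set w | dom f w /\ w \o j = u0 \o j]].
have infS : has_inf S.
  split; first by exists (en f u0 u0), u0.
  by exists 0 => _ [w [fw _] <-]; exact: psd_ge0.
have /choice[w wP] (k : nat) : exists w, [/\ dom f w, w \o j = u0 \o j &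
    en f w w < inf S + k.+1%:R^-1].
  have [] := inf_adherent (eps := k.+1%:R^-1) _ infS; first by rewrite invr_gt0.
  by move=> _ [w [fw wj] <-] h; exists w.
have fw k : dom f (w k) by case: (wP k).
have infle k l : 4 * inf S <= en f (w k + w l) (w k + w l).
  have -> : w k + w l = 2 *: (2^-1 *: (w k + w l)).
    by rewrite scalerA divff ?scale1r// pnatr_eq0.
  have fm : dom f (2^-1 *: (w k + w l)) by apply: domZ => //; exact: domD.
  rewrite (en_scale pf)// -natrX ler_wpM2l//.
  apply: ge_inf; first exact: infS.2.
  exists (2^-1 *: (w k + w l)) => //; split=> //; apply/funext => y /=.
  have [_ /(congr1 (@^~ y))/= hk _] := wP k.
  have [_ /(congr1 (@^~ y))/= hl _] := wP l.
  by rewrite !funE hk hl; field.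
have [] := cf w fw.
  move=> e e0; have e40 : 0 < e / 4 by rewrite divr_gt0.
  have [N _ hN] := near_infty_natSinv_lt (PosNum e40).
  exists N => m n Nm Nn; rewrite (parallelogram pf)//.
  have [_ _ hm] := wP m; have [_ _ hn] := wP n.
  have lm : m.+1%:R^-1 < e / 4 := hN m Nm.
  have ln : n.+1%:R^-1 < e / 4 := hN n Nn.
  have := infle m n; move: lm ln hm hn.
  move: (m.+1%:R^-1) (n.+1%:R^-1) => a b.
  by lra.
move=> v0 fv0 wv0.
pose c := u0 (j y0) - v0 (j y0).
pose v := v0 + (fun=> c).
have fv : dom f v by apply: domD => //; exact: psd_cst.
have wv : en f (w n - v) (w n - v) @[n --> \oo] --> (0 : R).
  suff -> : (fun n => en f (w n - v) (w n - v)) =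
            (fun n => en f (w n - v0) (w n - v0)) by [].
  apply/funext => n; rewrite -(en_addcst pf c (domB pf (fw n) fv)).
  by congr (en f _ _); rewrite /v; apply/funext => x; rewrite !funE; ring.
exists v; split=> //.
- apply/funext => y /=; have [C hC] := bf (j y) (j y0).
  have h n : (u0 (j y) - v (j y)) ^+ 2 <= C * en f (w n - v) (w n - v).
    have := hC _ (domB pf (fw n) fv); congr (_ ^+ 2 <= _).
    have [_ /[dup]/(congr1 (@^~ y))/= hy /(congr1 (@^~ y0))/= hy0 _] := wP n.
    by rewrite /v !funE hy hy0 /c; ring.
  have cv : (C * en f (w n - v) (w n - v)) @[n --> \oo] --> C * 0.
    by apply: cvgM => //; exact: cvg_cst.
  have := cvgr_to_ge cv (nearW _ h).
  rewrite mulr0 => h0; apply/esym/eqP; rewrite -subr_eq0 -sqrf_eq0.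
  by rewrite eq_le h0 sqr_ge0.
- move=> z fz zj; apply: (@le_trans _ _ (inf S)); last first.
    by apply: ge_inf; [exact: infS.2|exists z].
  have wQ := en_cvg pf fv fw wv.
  have inv0 : inf S + k.+1%:R^-1 @[k --> \oo] --> inf S + 0.
    by apply: cvgD; [exact: cvg_cst|exact: cvg_harmonic].
  rewrite -[leRHS]addr0; apply: (ler_cvg_to wQ inv0).
  by apply: nearW => k; apply: ltW; have [] := wP k.
Qed.


Section TraceOfForm.
Variables (R : realType) (X Y : Type) (j : Y -> X) (f : qform R X).
Hypothesis psdf : psd_form f.
Local Notation rho := (fun u : X -> R => u \o j).

Lemma trace_energy_min v : dom f v ->
    (forall w, dom f w -> rho w = rho v -> en f v v <= en f w w) ->
  trace_energy rho f (rho v) = en f v v.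
Proof.
move=> fv vmin; rewrite /trace_energy /set_min.
set S := [set _ | _ in _]; have Sv : (S `&` lbound S) (en f v v).
  split; first by exists v.
  by move=> _ [w [fw wv] <-]; exact: vmin.
apply: (get_unique Sv) => _ [[w [fw wv] <-] wmin].
by apply/eqP; rewrite eq_le vmin// andbT; apply: wmin; exists v.
Qed.

(** The polarized trace, evaluated on the diagonal, is a quarter of the energy
    of the double of a minimal extension. *)
Lemma trace_form_min (y0 : Y) u0 : complete_form f -> point_bounded f ->
    dom f u0 ->
  exists v, [/\ dom f v, rho v = rho u0,
    en f v v = en (trace_form rho f) (rho u0) (rho u0) &
    forall w, dom f w -> rho w = rho u0 -> en f v v <= en f w w].
Proof.
move=> cf bf fu0; have [v [fv vu vmin]] := min_extension j y0 psdf cf bf fu0.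
exists v; split=> //=.
have f2v := domZ psdf 2 fv.
have -> : (u0 \o j) \+ (u0 \o j) = (2 *: v) \o j.
  apply/funext => y /=; rewrite -[u0 (j y)]/((u0 \o j) y) -vu scalefE /=; ring.
have -> : (u0 \o j) \- (u0 \o j) = 0 \o j.
  by apply/funext => y /=; rewrite subrr.
rewrite trace_energy_min//; last first.
  move=> w fw wv; have f2w := domZ psdf 2^-1 fw.
  rewrite (en_scale psdf)//.
  have -> : w = 2 *: (2^-1 *: w) by rewrite scalerA divff ?scale1r// pnatr_eq0.
  rewrite (en_scale psdf _ f2w) ler_wpM2l ?sqr_ge0// vmin//.
  rewrite -vu; apply/funext => y /=; move/(congr1 (@^~ y)) : wv => /=.
  by rewrite !scalefE => ->; field.
rewrite trace_energy_min//; [|exact: dom0|].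
  rewrite (en0l psdf) ?(en_scale psdf)//; last exact: dom0.
  by rewrite subr0; field.
by move=> w fw _; rewrite (en0l psdf) ?psd_ge0//; exact: dom0.
Qed.

End TraceOfForm.

(** * Resistances *)

Section Resistance.
Variables (R : realType) (X : Type).
Implicit Types (f : qform R X) (u : X -> R).

Lemma resistance_ub f u x y : dom f u -> 0 < en f u u ->
  (((u x - u y) ^+ 2 / en f u u)%:E <= resistance f x y)%E.
Proof.
move=> fu u0; rewrite /resistance le_max; apply/orP; right.
by apply: ereal_sup_ubound; exists u => //; rewrite real_normK// num_real.
Qed.

Lemma resistance_le f x y (z : \bar R) : (0 <= z)%E ->
    (forall u, dom f u -> 0 < en f u u ->
      (((u x - u y) ^+ 2 / en f u u)%:E <= z)%E) ->
  (resistance f x y <= z)%E.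
Proof.
move=> z0 h; rewrite /resistance ge_max z0/=; apply: ge_ereal_sup.
by move=> _ [u [fu u0] <-]; rewrite real_normK ?num_real//; exact: h.
Qed.

Lemma resistance_ge0 f x y : (0 <= resistance f x y)%E.
Proof. by rewrite /resistance le_max lexx. Qed.

Lemma resistance_gt f x y (r : R) : 0 <= r -> (r%:E < resistance f x y)%E ->
  exists u, [/\ dom f u, 0 < en f u u & r * en f u u < (u x - u y) ^+ 2].
Proof.
move=> r0; rewrite /resistance lt_max => /orP[|].
  by rewrite lte_fin ltNge r0.
move=> /ereal_sup_gt[_ [u [fu u0] <-]].
rewrite lte_fin real_normK ?num_real// ltr_pdivlMr// => h.
by exists u.
Qed.

(** The function [z0] excludes the zero form, all of whose resistances are 0 by
    convention although they bound nothing. *)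
Lemma resistance_bound f x y (r : R) z0 : psd_form f ->
    dom f z0 -> 0 < en f z0 z0 -> resistance f x y = r%:E ->
  forall u, dom f u -> (u x - u y) ^+ 2 <= r * en f u u.
Proof.
move=> pf fz z0gt fr.
have bnd u : dom f u -> 0 < en f u u -> (u x - u y) ^+ 2 <= r * en f u u.
  by move=> fu u0; have := resistance_ub x y fu u0; rewrite fr lee_fin ler_pdivrMr.
move=> u fu; have [u0|u0] := ltP 0 (en f u u); first exact: bnd.
have Q0 : en f u u = 0 by apply/eqP; rewrite eq_le u0 psd_ge0.
rewrite Q0 mulr0; set d := u x - u y.
have [->|dn0] := eqVneq d 0; first by rewrite expr0n.
have B0 : en f z0 u = 0.
  have := cauchy_schwarz pf fz fu; rewrite Q0 mulr0 => h.
  by apply/eqP; rewrite -sqrf_eq0 eq_le h sqr_ge0.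
(* the energy of z0 + t u does not depend on t, its increment does *)
pose M := r * en f z0 z0.
pose t := (M + 1 - (z0 x - z0 y)) / d.
have ftu := domZ pf t fu.
have E : en f (z0 + t *: u) (z0 + t *: u) = en f z0 z0.
  by rewrite (en_expand pf)// B0 Q0 !mulr0 !addr0.
have := bnd _ (domD pf fz ftu); rewrite E => /(_ z0gt).
rewrite !funE -/M.
have -> : z0 x + t * u x - (z0 y + t * u y) = M + 1.
  have -> : z0 x + t * u x - (z0 y + t * u y) = z0 x - z0 y + t * d.
    by rewrite /d; ring.
  by rewrite /t -mulrA mulVf// mulr1; ring.
move=> h; have : 0 <= M by rewrite (le_trans (sqr_ge0 (z0 x - z0 y)))// bnd.
by move=> M0; nra.
Qed.

(** Increments and energies both pass to the limit, hence so do their ratios. *)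
Lemma resistance_dense f (W W' : set (X -> R)) x y : psd_form f ->
    W `<=` dom f -> W' `<=` dom f ->
    (forall u, W' u -> exists w : nat -> X -> R, [/\ forall k, W (w k),
       en f (w k - u) (w k - u) @[k --> \oo] --> (0 : R) &
       forall t, w k t @[k --> \oo] --> u t]) ->
  (resistance (subform f W') x y <= resistance (subform f W) x y)%E.
Proof.
move=> pf WD WD' dense; apply: resistance_le; first exact: resistance_ge0.
move=> u /= W'u u0; have fu := WD' _ W'u.
have [w [Ww wu wpt]] := dense u W'u.
case E : (resistance (subform f W) x y) => [r| |]; last 2 first.
- by rewrite leey.
- by have := resistance_ge0 (subform f W) x y; rewrite E.
have wQ := en_cvg pf fu (fun k => WD _ (Ww k)) wu.
have wl : (w k x - w k y) ^+ 2 @[k --> \oo] --> (u x - u y) ^+ 2.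
  by rewrite expr2; under eq_fun do rewrite expr2; apply: cvgM; apply: cvgB.
have wr : r * en f (w k) (w k) @[k --> \oo] --> r * en f u u.
  by apply: cvgM => //; exact: cvg_cst.
rewrite lee_fin ler_pdivrMr//; apply: (ler_cvg_to wl wr).
have pos : \forall k \near \oo, 0 < en f (w k) (w k).
  by move/cvgr_gt : wQ; apply.
near=> k; have k0 : 0 < en f (w k) (w k) by near: k.
have := @resistance_ub (subform f W) (w k) x y (Ww k) k0.
by rewrite E lee_fin ler_pdivrMr.
Unshelve. all: by end_near.
Qed.

End Resistance.

Definition clip (R : realType) (X : Type) (u : X -> R) : X -> R :=
  fun x => Num.min (Num.max 0 (u x)) 1.

Definition clip_closed (R : realType) (X : Type) (f : qform R X) : Prop :=
  forall u, dom f u -> dom f (clip u) /\ en f (clip u) (clip u) <= en f u u.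

Section Clip.
Variables (R : realType) (X : Type).
Implicit Types u v : X -> R.

Lemma clip_ge0 u x : 0 <= clip u x.
Proof. by rewrite /clip le_min ler01 le_max lexx. Qed.

Lemma clip_le1 u x : clip u x <= 1.
Proof. by rewrite /clip ge_min lexx orbT. Qed.

Lemma clip_id u x : 0 <= u x <= 1 -> clip u x = u x.
Proof. by move=> /andP[u0 u1]; rewrite /clip (max_idPr u0) (min_idPl u1). Qed.

Lemma sub_clip_min u v x : 0 <= u x <= 1 -> 0 <= v x <= 1 ->
  (u - clip (u - v)) x = Num.min (u x) (v x).
Proof.
move=> /andP[u0 u1] /andP[v0 v1]; rewrite !funE /clip !funE.
have [uv|uv] := leP (u x) (v x).
  by rewrite (max_idPl _) ?subr_le0// (min_idPl ler01) subr0.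
rewrite (max_idPr _) ?subr_ge0 ?ltW// (min_idPl _) ?subKr//.
by rewrite lerBlDr (le_trans u1)// lerDl.
Qed.

End Clip.

Section Separators.
Variables (R : realType) (X : choiceType) (f : qform R X).
Hypotheses (psdf : psd_form f) (clipf : clip_closed f).
Local Notation Q u := (en f u u).

Definition separator (x : X) (B : seq X) (w : X -> R) :=
  [/\ dom f w, forall t, 0 <= w t <= 1, w x = 1 & forall y, y \in B -> w y = 0].

Lemma separator1 x y u : dom f u -> u x != u y ->
  exists2 w, separator x [:: y] w & Q w <= Q u / (u x - u y) ^+ 2.
Proof.
move=> fu; rewrite -subr_eq0; set d := u x - u y => d0.
pose v := d^-1 *: (u + (fun=> - u y)).
have fc : dom f (u + (fun=> - u y)) by apply: domD => //; exact: psd_cst.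
have fv : dom f v by apply: domZ.
have [fw wv] := clipf fv.
have vx : v x = 1 by rewrite /v !funE -/d mulVf.
have vy : v y = 0 by rewrite /v !funE subrr mulr0.
exists (clip v).
  split=> //.
  - by move=> t; rewrite clip_ge0 clip_le1.
  - by rewrite clip_id vx// ler01 lexx.
  - by move=> t; rewrite inE => /eqP ->; rewrite clip_id vy// lexx ler01.
rewrite (le_trans wv)// (en_scale psdf)// (en_addcst psdf)//.
by rewrite exprVn mulrC.
Qed.

(** Separators from single points are combined by taking minima. For functions
    with values in [0, 1] the minimum of v and w is v - clip (v - w), which is
    how the Markov property controls its energy. *)
Lemma separator_seq x (B : seq X) :
    (forall y, y \in B -> forall e : R, 0 < e ->
       exists2 w, separator x [:: y] w & Q w <= e) ->
  forall e : R, 0 < e -> exists2 w, separator x B w & Q w <= e.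
Proof.
elim: B => [_ e e0|y B IH h e e0].
  exists (fun=> 1); last by rewrite psd_cst0// ltW.
  by split=> // [|t]; [exact: psd_cst|rewrite ler01 lexx].
have e10 : 0 < e / 10 by rewrite divr_gt0.
have [|v [fv v01 vx vy] vQ] := h y _ _ e10; first by rewrite inE eqxx.
have [|w [fw w01 wx wB] wQ] := IH _ _ e10.
  by move=> z zB; apply: h; rewrite inE zB orbT.
have fvw := domB psdf fv fw; have [fc cQ] := clipf fvw.
exists (v - clip (v - w)).
  split.
  - exact: domB.
  - move=> t; rewrite sub_clip_min// le_min ge_min.
    by case/andP: (v01 t) => -> ->; case/andP: (w01 t) => -> _.
  - by rewrite sub_clip_min// vx wx minxx.
  - move=> z; rewrite inE sub_clip_min// => /orP[/eqP ->|zB].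
      by rewrite vy ?inE// (min_idPl _)//; case/andP: (w01 y).
    by rewrite (wB _ zB) (min_idPr _)//; case/andP: (v01 z).
have := en_add_le2 psdf fv (domN psdf fc); rewrite (en_opp psdf fc).
have := en_add_le2 psdf fv (domN psdf fw); rewrite (en_opp psdf fw).
by lra.
Qed.

End Separators.

(** * Interpolation on finite sets *)

Section NearProjection.
Variables (R : realType) (X : Type) (f : qform R X) (W : set (X -> R)).
Hypotheses (psdf : psd_form f) (psdW : psd_form (subform f W)).
Hypothesis WD : W `<=` dom f.
Local Notation Q u := (en f u u).

(** Without completeness there is no orthogonal projection on [W], but a nearly
    closest point is nearly orthogonal. *)
Lemma near_projection u (k : R) : dom f u -> 0 < k ->
  exists2 w, W w &
    forall z, W z -> en f (u - w) z ^+ 2 <= k ^+ 2 * Q z.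
Proof.
move=> fu k0; pose S := [set Q (u - w) | w in W].
have fW w : W w -> dom f (u - w) by move=> /WD; exact: domB.
have infS : has_inf S.
  split; first by exists (Q (u - 0)), 0 => //; exact: (dom0 psdW).
  by exists 0 => _ [w Ww <-]; exact/psd_ge0/fW.
have [] := inf_adherent (eps := k ^+ 2) _ infS; first by rewrite exprn_gt0.
move=> _ [w Ww <-] wS; exists w => // z Wz; have fz := WD Wz.
apply: quadratic_discr; first exact: psd_ge0.
move=> t; have : inf S <= Q (u - w + t *: z).
  apply: ge_inf; first exact: infS.2.
  exists (w - t *: z); last by congr (en f _ _); rewrite opprB addrA addrAC.
  by apply: (domB psdW) => //; exact: (domZ psdW).
rewrite (en_expand psdf)//; last exact: fW.
by lra.
Qed.

(** If [W] computes the same resistance [r] between [x] and [y] as the whole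
    form, then [x] and [y] are nearly extremal within [W], and an increment
    that cannot be seen from [W] costs more than [r] allows. This is
    Cauchy-Schwarz for the non-negative form r E(u, v) - (u x - u y) (v x - v y). *)
Lemma near_orthogonal_increment x y (r k : R) h : dom f h -> 0 < k ->
    (forall u, dom f u -> (u x - u y) ^+ 2 <= r * Q u) ->
    resistance (subform f W) x y = r%:E ->
    (forall z, W z -> en f h z ^+ 2 <= k ^+ 2 * Q z) ->
  (h x - h y) ^+ 2 <= 6 * r * k ^+ 2.
Proof.
move=> fh k0 bnd resW orth.
have r0 : 0 <= r by have := resistance_ge0 (subform f W) x y; rewrite resW.
have [r0'|{}r0] := leP r 0.
  have rE : r = 0 by apply/eqP; rewrite eq_le r0 r0'.
  by have := bnd h fh; rewrite rE mul0r mulr0 mul0r.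
set l := h x - h y; pose C := r * Q h - l ^+ 2.
have C0 : 0 <= C by rewrite subr_ge0 bnd.
(* [w] is extremal up to the loss [d], small enough for its contribution to be
   absorbed by the one of [k] *)
pose d := Num.min (r / 2) (r ^+ 2 * k ^+ 2 / (2 * (C + 1))).
have C1 : 0 < 2 * (C + 1) by lra.
have rk0 : 0 < r ^+ 2 * k ^+ 2 by rewrite mulr_gt0// exprn_gt0.
have d0 : 0 < d by rewrite lt_min !divr_gt0.
have d1 : d <= r / 2 by rewrite ge_min lexx.
have d2 : 2 * d * C <= r ^+ 2 * k ^+ 2.
  have : d <= r ^+ 2 * k ^+ 2 / (2 * (C + 1)) by rewrite ge_min lexx orbT.
  by rewrite ler_pdivlMr// => h'; nra.
have rd0 : 0 <= r - d by lra.
have := @resistance_gt _ _ (subform f W) x y _ rd0.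
rewrite resW lte_fin => -[|w [/= Ww w0]]; first by lra.
have fw := WD Ww; set q := Q w in w0 *; set s := w x - w y => sq.
have sq' : s ^+ 2 <= r * q := bnd w fw.
have CS : (r * en f h w - l * s) ^+ 2 <= C * (r * q - s ^+ 2).
  apply: quadratic_discr; first by rewrite subr_ge0.
  move=> t; have := bnd _ (domD psdf fh (domZ psdf t fw)).
  rewrite (en_expand psdf)// !funE.
  have -> : h x + t * w x - (h y + t * w y) = l + t * s by rewrite /l /s; ring.
  by rewrite -subr_ge0 /C -/q => /le_trans; apply; lra.
have B : en f h w ^+ 2 <= k ^+ 2 * q := orth w Ww.
set b := en f h w in CS B.
have : l ^+ 2 * s ^+ 2 <= 2 * (r * b) ^+ 2 + 2 * (r * b - l * s) ^+ 2.
  have := sqr_ge0 (2 * (r * b) - l * s); lra.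
have : 2 * (r * b) ^+ 2 <= 2 * r ^+ 2 * (k ^+ 2 * q).
  have r20 : 0 <= 2 * r ^+ 2 by rewrite mulr_ge0// sqr_ge0.
  have := ler_wpM2l r20 B; lra.
have : C * (r * q - s ^+ 2) <= C * (d * q) by rewrite ler_wpM2l//; lra.
have : 2 * (C * (d * q)) <= r ^+ 2 * k ^+ 2 * q.
  have := ler_wpM2r (ltW w0) d2; lra.
have : l ^+ 2 * (r / 2 * q) <= l ^+ 2 * s ^+ 2.
  apply: ler_wpM2l; first exact: sqr_ge0.
  have : r / 2 * q <= (r - d) * q by rewrite ler_pM2r//; lra.
  by lra.
move=> h1 h2 h3 h4 h5.
have : (l ^+ 2 * (r / 2)) * q <= (3 * r ^+ 2 * k ^+ 2) * q by lra.
rewrite ler_pM2r// => h6.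
have : l ^+ 2 * r <= (6 * r * k ^+ 2) * r by lra.
by rewrite ler_pM2r.
Qed.

End NearProjection.

Section Interpolation.
Variables (R : realType) (X : choiceType) (f : qform R X) (W : set (X -> R)).
Hypotheses (psdf : psd_form f) (psdW : psd_form (subform f W)).
Hypotheses (WD : W `<=` dom f) (clipW : clip_closed (subform f W)).
Local Notation Q u := (en f u u).
Local Notation N := (enorm f).

(** The separators of the zero form on [W], which satisfies the hypotheses of
    [separator_seq] for trivial reasons. *)
Lemma dual_basis (s : seq X) :
    (forall x y, x \in s -> y \in s -> x != y -> exists2 w, W w & w x != w y) ->
  forall x, x \in s -> exists w, [/\ W w, w x = 1 &
    forall y, y \in s -> y != x -> w y = 0].
Proof.
move=> sep x xs; pose g : qform R X := QForm W (fun _ _ => 0).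
have psdg : psd_form g.
  split=> //=; [exact: (psd_cst psdW)|exact: (psd_lin psdW)|].
  by move=> *; rewrite mulr0 addr0.
have clipg : clip_closed g by move=> u Wu; split=> //; exact: (clipW Wu).1.
have [|w [Ww _ wx wB] _] := separator_seq psdg clipg (x := x)
    (B := [seq y <- s | y != x]) _ ltr01.
  move=> y; rewrite mem_filter => /andP[yx ys] e e0.
  have [|u Wu uxy] := sep x y xs ys; first by rewrite eq_sym.
  have [w sw wQ] := separator1 psdg clipg Wu uxy.
  by exists w => //; rewrite (le_trans wQ)// mul0r ltW.
by exists w; split=> // y ys yx; apply: wB; rewrite mem_filter yx.
Qed.

Lemma infinite_resistance_separator x y : resistance (subform f W) x y = +oo%E ->
  forall e : R, 0 < e -> exists2 w, separator (subform f W) x [:: y] w & Q w <= e.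
Proof.
move=> resoo e e0; have ie0 : 0 <= e^-1 by rewrite invr_ge0 ltW.
have := @resistance_gt _ _ (subform f W) x y _ ie0.
rewrite resoo ltry => /(_ isT)[u [/= Wu u0 lt_u]].
have d0 : 0 < (u x - u y) ^+ 2.
  by rewrite (le_lt_trans _ lt_u)// mulr_ge0// ltW.
have uxy : u x != u y.
  by apply: contraTneq d0 => ->; rewrite subrr expr0n ltxx.
have [w sw wQ] := separator1 psdW clipW Wu uxy.
exists w => //; rewrite (le_trans wQ)//= ler_pdivrMr//.
by rewrite -ler_pdivrMl// ltW.
Qed.

(** Finite resistance is an equivalence relation between points. A function
    that is nearly constant on each class is nearly equal, on a finite set, to
    one of arbitrarily small energy: points are added one by one, either
    following a point of the same class or being corrected by a separator of
    small energy. *)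
Lemma low_energy_interpolation (s : seq X) :
    (forall x y, x \in s -> y \in s -> resistance (subform f W) x y != +oo%E ->
       exists C, forall w, W w -> (w x - w y) ^+ 2 <= C * Q w) ->
  forall e : R, 0 < e -> exists2 d : R, 0 < d & forall h : X -> R,
    (forall x y, x \in s -> y \in s -> resistance (subform f W) x y != +oo%E ->
       `|h x - h y| <= d) ->
    exists z, [/\ W z, N z <= e & forall x, x \in s -> `|z x - h x| <= e].
Proof.
elim: s => [_ e e0|x s IH bnd e e0].
  exists 1 => // h _; exists 0; split=> //; first exact: (dom0 psdW).
  by rewrite /enorm (en0l psdf) ?sqrtr0 ?ltW//; exact: (dom0 psdf).
have sub a : a \in s -> a \in x :: s by rewrite inE => ->; rewrite orbT.
have {}IH := IH (fun a b sa sb => bnd a b (sub a sa) (sub b sb)).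
have [[y ys resxy]|unrelated] := pselect (exists2 y, y \in s &
    resistance (subform f W) x y != +oo%E).
  have [|C0 hC0] := bnd x y (mem_head _ _) _ resxy; first by rewrite inE ys orbT.
  have [C C0' hC] : exists2 C, 0 <= C & forall w, W w -> (w x - w y) ^+ 2 <= C * Q w.
    exists `|C0| => // w Ww; rewrite (le_trans (hC0 w Ww))//.
    by rewrite ler_wpM2r ?ler_norm//; exact: (psd_ge0 psdf (WD Ww)).
  have C1 : 0 < 3 * (C + 1) by lra.
  pose e' := e / (3 * (C + 1)).
  have e'0 : 0 < e' by rewrite divr_gt0.
  have e'E : e' * (3 * (C + 1)) = e by rewrite /e' mulfVK// gt_eqF.
  have [d d0 hd] := IH _ e'0.
  exists (Num.min d (e / 3)); first by rewrite lt_min d0 divr_gt0.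
  move=> h hh; have [|z [Wz Nz zh]] := hd h.
    move=> a b sa sb rab; have := hh a b (sub a sa) (sub b sb) rab.
    by rewrite le_min => /andP[].
  exists z; split=> //; first by rewrite (le_trans Nz)//; nra.
  move=> t; rewrite inE => /orP[/eqP ->|ts]; last first.
    by rewrite (le_trans (zh t ts))//; nra.
  have ysx : y \in x :: s by rewrite inE ys orbT.
  have := hh x y (mem_head _ _) ysx resxy; rewrite le_min => /andP[_ hxy].
  have zy := zh y ys.
  have zxy : `|z x - z y| <= e / 3.
    rewrite -ler_sqr ?nnegrE ?divr_ge0 ?(ltW e0)// real_normK ?num_real//.
    rewrite (le_trans (hC z Wz))// -(sqr_enorm psdf (WD Wz)).
    have N2 : N z ^+ 2 <= e' ^+ 2.
      by rewrite ler_sqr ?nnegrE ?enorm_ge0// ltW.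
    have -> : e / 3 = e' * (C + 1) by rewrite -e'E; field.
    rewrite (le_trans (ler_wpM2l C0' N2))//.
    have CC : 0 <= e' ^+ 2 * (C ^+ 2 + C + 1).
      by rewrite mulr_ge0 ?sqr_ge0// addr_ge0// addr_ge0// sqr_ge0.
    lra.
  have -> : z x - h x = (z x - z y) + (z y - h y) - (h x - h y) by ring.
  rewrite (le_trans (ler_normB _ _))//.
  rewrite (le_trans (lerD (ler_normD _ _) (lexx _)))//.
  have e'3 : e' <= e / 3 by nra.
  lra.
have e20 : 0 < e / 2 by rewrite divr_gt0.
have [d d0 hd] := IH _ e20.
exists d => // h hh; have [|z [Wz Nz zh]] := hd h.
  move=> a b sa sb rab; exact: (hh a b (sub a sa) (sub b sb) rab).
pose c := h x - z x.
have c1 : 0 < 2 * (`|c| + 1) by rewrite mulr_gt0// ltr_wpDl.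
pose e' := e / (2 * (`|c| + 1)).
have e'0 : 0 < e' by rewrite divr_gt0.
have e'E : e' * (2 * (`|c| + 1)) = e by rewrite /e' mulfVK// gt_eqF.
have [|w [/= Ww _ wx wB] wQ] := separator_seq psdW clipW (x := x) (B := s) _
    (exprn_gt0 2 e'0).
  move=> y ys; apply: infinite_resistance_separator.
  by apply/eqP/negPn/negP => rxy; apply: unrelated; exists y.
have Nw : N w <= e'.
  by rewrite -ler_sqr ?nnegrE ?enorm_ge0 ?(ltW e'0)// (sqr_enorm psdf (WD Ww)).
have Wcw := domZ psdW c Ww.
exists (z + c *: w); split.
- exact: (domD psdW).
- rewrite (le_trans (enormD psdf (WD Wz) (WD Wcw)))// (enormZ psdf)//; last exact: WD.
  have : `|c| * N w <= `|c| * e' by rewrite ler_wpM2l.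
  have := normr_ge0 c; nra.
- move=> t; rewrite inE !funE => /orP[/eqP ->|ts].
    rewrite wx mulr1; have -> : z x + c - h x = 0 by rewrite /c; ring.
    by rewrite normr0 ltW.
  by rewrite wB// mulr0 addr0 (le_trans (zh t ts))//; lra.
Qed.

Lemma enorm_sum (s : seq X) (c : X -> R) (w : X -> X -> R) e :
    (forall x, x \in s -> W (w x)) -> (forall x, x \in s -> `|c x| <= e) ->
  W (\sum_(x <- s) c x *: w x) /\
  N (\sum_(x <- s) c x *: w x) <= e * \sum_(x <- s) N (w x).
Proof.
elim: s => [_ _|x s IH Ww ce].
  rewrite !big_nil mulr0 /enorm (en0l psdf) ?sqrtr0; last exact: (dom0 psdf).
  by split => //; exact: (dom0 psdW).
have [|t ts|Ws Ns] := IH.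
- by move=> t ts; apply: Ww; rewrite inE ts orbT.
- by apply: ce; rewrite inE ts orbT.
have Wx := Ww x (mem_head _ _); have Wcx := domZ psdW (c x) Wx.
rewrite !big_cons; split; first exact: (domD psdW).
rewrite (le_trans (enormD psdf (WD Wcx) (WD Ws)))// mulrDr lerD//.
rewrite (enormZ psdf) ?ler_wpM2r ?enorm_ge0 ?ce ?mem_head//; exact: WD.
Qed.

(** The energy that [W] needs in order to interpolate on a finite set is
    determined by resistances. Subtract from [u] a near projection on [W]: the
    rest is nearly constant on the classes of points at finite resistance, by
    [near_orthogonal_increment], so it can be replaced on the finite set by an
    element of [W] without energy. The small error that remains is corrected
    with a dual basis. *)
Lemma interpolation (s : seq X) (z0 : X -> R) : uniq s ->
    dom f z0 -> 0 < Q z0 ->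
    (forall x y, x \in s -> y \in s -> x != y ->
       exists2 u, dom f u & u x != u y) ->
    (forall x y, x \in s -> y \in s ->
       resistance f x y = resistance (subform f W) x y) ->
  forall u (e : R), dom f u -> 0 < e ->
  exists w, [/\ W w, forall x, x \in s -> w x = u x & Q w <= Q u + e].
Proof.
move=> us fz0 z0gt sep res u e fu e0.
have finres x y : x \in s -> y \in s -> resistance (subform f W) x y != +oo%E ->
    exists2 r, resistance (subform f W) x y = r%:E &
      forall v, dom f v -> (v x - v y) ^+ 2 <= r * Q v.
  move=> xs ys; rewrite -res//; case E : (resistance f x y) => [r| |]// _.
    by exists r => //; exact: resistance_bound z0gt E.
  by have := resistance_ge0 f x y; rewrite E.
have sepW x y : x \in s -> y \in s -> x != y -> exists2 w, W w & w x != w y.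
  move=> xs ys xy; have [v fv vxy] := sep x y xs ys xy.
  have d0 : 0 < (v x - v y) ^+ 2 by rewrite exprn_even_gt0//= subr_eq0.
  have : (0%:E < resistance (subform f W) x y)%E.
    rewrite lt_neqAle resistance_ge0 andbT; apply/negP => /eqP r0.
    have [|r rE bnd] := finres x y xs ys; first by rewrite -r0.
    have := bnd v fv; move: rE; rewrite -r0 => -[<-].
    by rewrite mul0r leNgt d0.
  move=> /(resistance_gt (lexx 0))[w [/= Ww w0]].
  rewrite mul0r => wxy; exists w => //.
  by apply: contraTneq wxy => ->; rewrite subrr expr0n ltxx.
have /choice[psi psiP] (x : X) : exists w, x \in s ->
    [/\ W w, w x = 1 & forall y, y \in s -> y != x -> w y = 0].
  have [xs|xs] := boolP (x \in s); last by exists 0.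
  by have [w ?] := dual_basis sepW xs; exists w.
pose C0 := \sum_(x <- s) N (psi x).
have C0ge0 : 0 <= C0 by rewrite sumr_ge0// => x _; exact: enorm_ge0.
pose r (p : X * X) := `|fine (resistance (subform f W) p.1 p.2)|.
have rge0 p : 0 <= r p by exact: normr_ge0.
pose C := \sum_(x <- s) \sum_(y <- s) r (x, y).
have Cge x y : x \in s -> y \in s -> r (x, y) <= C.
  move=> xs ys; rewrite /C (big_rem x)//= (big_rem y)//= -addrA lerDl addr_ge0//.
    by apply: sumr_ge0.
  by apply: sumr_ge0 => *; apply: sumr_ge0.
have Cge0 : 0 <= C by apply: sumr_ge0 => *; apply: sumr_ge0.
(* t bounds the loss in the norm, eps and k the errors that are responsible
   for it *)
pose Nu := N u; have Nu0 : 0 <= Nu := enorm_ge0 f u.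
pose t := Num.min 1 (e / (2 * Nu + 1)).
have t0 : 0 < t by rewrite lt_min ltr01 divr_gt0//; lra.
have t1 : t <= 1 by rewrite ge_min lexx.
have te : t * (2 * Nu + 1) <= e.
  by rewrite -ler_pdivlMr ?ge_min ?lexx ?orbT//; lra.
pose eps := t / (2 * (1 + C0)).
have eps0 : 0 < eps by rewrite divr_gt0//; lra.
have epsE : eps * (1 + C0) = t / 2.
  by rewrite /eps; field; rewrite gt_eqF//; lra.
have [|d d0 hd] := low_energy_interpolation (s := s) _ eps0.
  move=> x y xs ys rxy; have [r' _ bnd] := finres x y xs ys rxy.
  by exists r' => w /WD; exact: bnd.
pose k := Num.min (t / 8) (d / (6 * (C + 1))).
have C1 : 0 < 6 * (C + 1) by lra.
have k0 : 0 < k by rewrite lt_min !divr_gt0.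
have kt : k <= t / 8 by rewrite ge_min lexx.
have kd : k * (6 * (C + 1)) <= d by rewrite -ler_pdivlMr// ge_min lexx orbT.
have [w Ww orth] := near_projection psdf psdW WD fu k0.
have fw := WD Ww; have fh := domB psdf fu fw.
have [|z [Wz Nz zh]] := hd (u - w).
  move=> x y xs ys rxy; have [r' rE bnd] := finres x y xs ys rxy.
  rewrite -ler_sqr ?nnegrE ?(ltW d0)// real_normK ?num_real//.
  apply: (le_trans (near_orthogonal_increment psdf WD fh k0 bnd rE orth)).
  have : r' <= C.
    by rewrite (le_trans _ (Cge x y xs ys))// /r /= rE /= ler_norm.
  have k20 : 0 <= k ^+ 2 by rewrite sqr_ge0.
  move=> r'C; have : 6 * r' * k ^+ 2 <= 6 * (C + 1) * k ^+ 2.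
    by rewrite ler_wpM2r//; lra.
  move=> /le_trans; apply; have kd' : k <= d by nra.
  have := ler_wpM2r (ltW k0) kd; have := ler_wpM2l (ltW d0) kd'; lra.
have fz := WD Wz; pose w' := w + z.
have Ww' : W w' by exact: (domD psdW).
have [||Wc Nc] := @enorm_sum s (u - w') psi eps.
- by move=> x xs; have [] := psiP x xs.
- move=> x /zh; rewrite /w' !funE distrC; congr (`|_| <= _); ring.
exists (w' + \sum_(x <- s) (u - w') x *: psi x); split.
- exact: (domD psdW).
- move=> y ys; rewrite addfE.
  have -> : (\sum_(x <- s) (u - w') x *: psi x) y =
      \sum_(x <- s) (u - w') x * psi x y.
    by elim: (s) => [|a s' IH]; rewrite ?big_nil// !big_cons -IH.
  rewrite (bigD1_seq y)//= big1_seq => [|x /andP[xy xs]].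
    have [_ -> _] := psiP y ys; rewrite !funE; ring.
  by have [_ _ ->] := psiP x xs; rewrite ?mulr0// eq_sym.
have Nw : N w <= Nu + 2 * k.
  have B : `|en f (u - w) w| <= k * N w.
    rewrite -ler_sqr ?nnegrE ?mulr_ge0 ?enorm_ge0 ?(ltW k0)//.
    by rewrite real_normK ?num_real// exprMn (sqr_enorm psdf fw) orth.
  have : Nu ^+ 2 = Q (u - w) + 2 * en f (u - w) w + N w ^+ 2.
    by rewrite /Nu !(sqr_enorm psdf)// -(en_add psdf)// subrK.
  have := psd_ge0 psdf fh; move: B; rewrite ler_norml => /andP[B _] Qh NuE.
  have N0 := enorm_ge0 f w; rewrite leNgt; apply/negP => lt; nra.
have Nw'' : N (w' + \sum_(x <- s) (u - w') x *: psi x) <= Nu + t.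
  rewrite (le_trans (enormD psdf (WD Ww') (WD Wc)))//.
  have := enormD psdf fw fz; rewrite -/w'.
  by move: Nc; rewrite -/C0; lra.
rewrite -(sqr_enorm psdf fu) -/Nu -(sqr_enorm psdf); last exact/WD/(domD psdW).
have N0 := enorm_ge0 f (w' + \sum_(x <- s) (u - w') x *: psi x).
by nra.
Qed.

End Interpolation.

(** * Limits of eventually increasing forms *)

Section LimitForm.
Variables (R : realType) (X : Type) (q : nat -> (X -> R) -> (X -> R) -> R).
Variable N0 : nat.
Hypothesis psdq : forall n, psd_form (QForm setT (q n)).
Hypothesis q_mono : forall n, (N0 <= n)%N -> forall u, q n u u <= q n.+1 u u.

(** Monotonicity is only required from [N0] on, because the energies inside a
    cell need not increase at the first levels. *)
Definition lim_form : qform R X := QForm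
  [set u | (limn (fun n => (q n u u)%:E) < +oo)%E]
  (fun u v => limn (fun n => q n u v)).

Lemma q_homo m n : (N0 <= m)%N -> (m <= n)%N -> forall u, q m u u <= q n u u.
Proof.
move=> Nm /subnK <-; elim: (n - m)%N => [u|k IH u]; first by rewrite add0n.
by rewrite (le_trans (IH u))// addSn q_mono// (leq_trans Nm)// leq_addl.
Qed.

Lemma lim_domP u : dom lim_form u <->
  exists C, forall n, (N0 <= n)%N -> q n u u <= C.
Proof.
have cvE : (q n u u)%:E @[n --> \oo] -->
    ereal_sup (range (fun n => (q (n + N0)%N u u)%:E)).
  rewrite -(cvg_shiftn N0); apply: ereal_nondecreasing_cvgn => m n mn.
  by rewrite lee_fin q_homo// ?leq_addl// leq_add2r.
rewrite /lim_form /= (cvg_lim _ cvE)//; set l := ereal_sup _.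
have lub n : (N0 <= n)%N -> ((q n u u)%:E <= l)%E.
  by move=> Nn; apply: ereal_sup_ubound; exists (n - N0)%N => //; rewrite subnK.
split=> [loo|[C hC]]; last first.
  apply: (@le_lt_trans _ _ C%:E); last by rewrite ltry.
  by apply: ge_ereal_sup => _ [n _ <-]; rewrite lee_fin hC// leq_addl.
case E : l => [C| |].
- by exists C => n /lub; rewrite E lee_fin.
- by move: loo; rewrite E.
- by have := lub N0 (leqnn _); rewrite E.
Qed.

Lemma lim_cvg_diag u : dom lim_form u ->
  q n u u @[n --> \oo] --> en lim_form u u.
Proof.
move=> /lim_domP[C hC]; apply: (@cvgP _ _ _ _).
rewrite -(cvg_shiftn N0).
apply: nondecreasing_cvgn => [m n mn|].
  by rewrite q_homo// ?leq_addl// leq_add2r.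
by exists C => _ [n _ <-]; rewrite hC// leq_addl.
Qed.

Lemma lim_en_ge u n : dom lim_form u -> (N0 <= n)%N ->
  q n u u <= en lim_form u u.
Proof.
move=> du Nn; apply: (cvgr_to_ge (lim_cvg_diag du)).
by near=> m; apply: q_homo => //; near: m; exact: nbhs_infty_ge.
Unshelve. all: by end_near. Qed.

Lemma lim_en_le u C : (forall n, (N0 <= n)%N -> q n u u <= C) ->
  dom lim_form u /\ en lim_form u u <= C.
Proof.
move=> hC; have du : dom lim_form u by apply/lim_domP; exists C.
split=> //; apply: (cvgr_to_le (lim_cvg_diag du)).
by near=> m; apply: hC; near: m; exact: nbhs_infty_ge.
Unshelve. all: by end_near. Qed.

Lemma lim_domD a u v : dom lim_form u -> dom lim_form v ->
  dom lim_form (a *: u + v).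
Proof.
move=> /lim_domP[C hC] /lim_domP[D hD]; apply/lim_domP.
exists (2 * (a ^+ 2 * C) + 2 * D) => n Nn.
have := en_add_le2 (psdq n) (u := a *: u) (v := v) I I => /= /le_trans; apply.
rewrite lerD ?ler_wpM2l ?hD//.
by have /= -> := @en_scale _ _ _ (psdq n) a u I; rewrite ler_wpM2l ?sqr_ge0// hC.
Qed.

Lemma lim_cvg u v : dom lim_form u -> dom lim_form v ->
  q n u v @[n --> \oo] --> en lim_form u v.
Proof.
move=> du dv; apply: (@cvgP _ _ _ _).
have dD : dom lim_form (u + v) by rewrite -[u]scale1r; exact: lim_domD.
have dB : dom lim_form (u - v) by rewrite addrC -scaleN1r; exact: lim_domD.
have -> : (fun n => q n u v) =
    (fun n => (q n (u + v) (u + v) - q n (u - v) (u - v)) * 4^-1).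
  apply/funext => n.
  have /= -> := @en_add _ _ _ (psdq n) u v I I.
  have /= -> := @en_sub _ _ _ (psdq n) u v I I.
  by field.
by apply: cvgM; [apply: cvgB; exact: lim_cvg_diag|exact: cvg_cst].
Qed.

Lemma psd_lim_form : psd_form lim_form.
Proof.
have cst0 n c : q n (fun=> c) (fun=> c) = 0 := psd_cst0 (psdq n) c.
split.
- by move=> c; apply/lim_domP; exists 0 => n _; rewrite cst0.
- exact: lim_domD.
- move=> u v du dv; congr (limn _); apply/funext => n.
  exact: (psd_sym (psdq n)).
- move=> a u v w du dv dw; apply/cvg_lim => //.
  have -> : (fun n => q n (a *: u + v) w) = (fun n => a * q n u w + q n v w).
    by apply/funext => n; exact: (psd_bilin (psdq n)).
  by apply: cvgD; [apply: cvgM; [exact: cvg_cst|]|]; exact: lim_cvg.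
- move=> u du; apply: (cvgr_to_ge (lim_cvg_diag du)).
  by apply: nearW => n; exact: (psd_ge0 (psdq n)).
- move=> c /=; apply/cvg_lim => //.
  by under eq_fun do rewrite cst0; exact: cvg_cst.
Qed.

Lemma clip_lim_form : (forall n, clip_closed (QForm setT (q n))) ->
  clip_closed lim_form.
Proof.
move=> clipq u du; apply: lim_en_le => n Nn.
by rewrite (le_trans (clipq n u I).2)// lim_en_ge.
Qed.

End LimitForm.

(** * Combinatorics of cells *)

Lemma finite_nat_bound (I : choiceType) (D : set I) (f : I -> nat) :
  finite_set D -> exists M, forall i, D i -> (f i <= M)%N.
Proof.
move=> /finite_seqP[s ->]; exists (\max_(i <- s) f i)%N => i /= si.
exact: leq_bigmax_seq.
Qed.

Section Cells.
Variables (R : realType) (T A : choiceType) (S : cell_structure R T A).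
Hypothesis fr : finitely_ramified S.
Local Notation K := (K_ S).
Local Notation V := (V_ S).
Local Notation F := (filt S).

Lemma V_sub_K a : V a `<=` K a.
Proof. by have [] := frc_c_sub fr a. Qed.

Lemma K_interior a : exists2 x, K a x & ~ V a x.
Proof.
have [_ nKV] := frc_c_sub fr a.
apply: contrapT => h; apply: nKV => x Kx.
by apply: contrapT => Vx; apply: h; exists x.
Qed.

Lemma level_unique m n a : F m a -> F n a -> m = n.
Proof. by move=> Fm Fn; apply: (frc_f_disj fr) => //; exists a. Qed.

Lemma K_cap_V n a b x : F n a -> F n b -> a <> b -> K a x -> K b x ->
  V a x /\ V b x.
Proof.
move=> Fa Fb ab Kax Kbx.
have : (K a `&` K b) x by split.
by rewrite (frc_g fr Fa Fb ab).
Qed.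

Lemma children n a x : F n a -> K a x ->
  exists b, [/\ F n.+1 b, K b `<=` K a & K b x].
Proof.
move=> Fa Kax; have [B BF KB] := frc_f_sub fr Fa.
have [b Bb Kbx] : (\bigcup_(b in B) K b) x by rewrite -KB.
by exists b; split=> //; [exact: BF|by rewrite KB => y Kby; exists b].
Qed.

Lemma level_cover n x : exists2 a, F n a & K a x.
Proof.
elim: n => [|n [a Fa Kax]].
  by exists (Defs.root S); rewrite ?(frc_f0 fr) ?(frc_f_root fr).
by have [b [Fb _ Kbx]] := children Fa Kax; exists b.
Qed.

(** A point of [b] that is not a vertex lies in no other cell of the same level,
    hence a cell above that contains this point contains [b]. *)
Lemma parent n b : F n.+1 b -> exists2 a, F n a & K b `<=` K a.
Proof.
move=> Fb; have [x Kbx nVbx] := K_interior b.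
have [a Fa Kax] := level_cover n x; have [c [Fc Kca Kcx]] := children Fa Kax.
have [cb|cb] := pselect (c = b); first by exists a; rewrite -?cb.
by have [_ /nVbx] := K_cap_V Fc Fb cb Kcx Kbx.
Qed.

Lemma ancestor m n b : (m <= n)%N -> F n b -> exists2 a, F m a & K b `<=` K a.
Proof.
move=> /subnK <-; elim: (n - m)%N b => [|k IH] b; first by exists b.
rewrite addSn => /parent[a /IH[c Fc Kac] Kba].
by exists c => //; exact: subset_trans Kac.
Qed.

Lemma child_proper n a b : F n a -> F n.+1 b -> K b `<=` K a -> K b `<` K a.
Proof.
move=> Fa Fb Kba; split=> // Kab.
have ab : a = b by apply: (frc_b_inj fr); apply/seteqP.
by rewrite ab in Fa; have /esym/n_Sn := level_unique Fb Fa.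
Qed.

Lemma level_of a : exists n, F n a.
Proof.
have : [set: A] a by []. by rewrite -(frc_f_cover fr) => -[n _ Fa]; exists n.
Qed.

(** Every cell has a proper subcell, so a finite one would start an infinite
    descent of cardinals. *)
Lemma K_infinite a : infinite_set (K a).
Proof.
move=> finK.
suff h k b : finite_set (K b) -> (#|` fset_set (K b)| < k)%N -> False.
  exact: (h _ a finK (leqnn _)).
elim: k b => [b _|k IH b finb]; first by rewrite ltn0.
rewrite ltnS => bk; have [n Fb] := level_of b.
have [x Kbx _] := K_interior b; have [c [Fc Kcb _]] := children Fb Kbx.
have finc : finite_set (K c) := sub_finite_set Kcb finb.
apply: (IH c finc); apply: leq_trans bk; apply: fproper_ltn_card.
have [_ nKbc] := child_proper Fb Fc Kcb.
rewrite fproperE; apply/andP; split.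
  by apply/fsubsetP => y; rewrite !in_fset_set// !inE; exact: Kcb.
apply/negP => /fsubsetP bc; apply: nKbc => y Kby.
by have := bc y; rewrite !in_fset_set// !inE; exact.
Qed.

(** Two cells of one level have finitely many common points, too few for a third
    cell. *)
Lemma ancestor_unique n a b c : F n a -> F n b -> K c `<=` K a ->
  K c `<=` K b -> a = b.
Proof.
move=> Fa Fb Kca Kcb; apply: contrapT => ab; apply: (@K_infinite c).
apply: sub_finite_set (frc_c_fin fr a) => x Kcx.
by have [] := K_cap_V Fa Fb ab (Kca _ Kcx) (Kcb _ Kcx).
Qed.

Lemma descendant_sub m n a b c : F m a -> F n b -> (m <= n)%N ->
  K c `<=` K a -> K c `<=` K b -> K b `<=` K a.
Proof.
move=> Fa Fb mn Kca Kcb; have [a' Fa' Kba'] := ancestor mn Fb.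
by rewrite (ancestor_unique Fa Fa' Kca (subset_trans Kcb Kba')).
Qed.

Lemma VnS n : Vn S n `<=` Vn S n.+1.
Proof.
move=> x [a Fa Vax]; have [B BF KB] := frc_f_sub fr Fa.
have finB : finite_set B := sub_finite_set BF (frc_f_fin fr n.+1).
by have [b Bb Vbx] := frc_e fr finB KB Vax; exists b => //; exact: BF.
Qed.

Lemma Vn_le m n : (m <= n)%N -> Vn S m `<=` Vn S n.
Proof.
move=> /subnK <-; elim: (n - m)%N => // k IH x /IH; exact: VnS.
Qed.

Lemma Vn_cover x : exists n, Vn S n x.
Proof.
have : [set: T] x by []. by rewrite -(frc_vertices fr) => -[n _ Vx]; exists n.
Qed.

Lemma Vn_point n : exists x, Vn S n x.
Proof.
have [x [_ [Vx _ _]]] := frc_c_two fr (Defs.root S).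
exists x; apply: (Vn_le (leq0n n)); exists (Defs.root S) => //.
by rewrite (frc_f0 fr).
Qed.

Lemma Vn_cell n a x : F n a -> Vn S n x -> K a x -> V a x.
Proof.
move=> Fa [b Fb Vbx] Kax; have [<-//|ba] := pselect (b = a).
by have [] := K_cap_V Fa Fb (nesym ba) Kax (V_sub_K Vbx).
Qed.

(** Cells that contain both of two given points disappear from some level on:
    the finitely branching tree of the cells that have such descendants at all
    levels would otherwise have an infinite branch, which contradicts the
    shrinking of decreasing sequences of cells. *)
Lemma cells_separate p q : p <> q ->
  exists N, forall n b, (N <= n)%N -> F n b -> K b p -> K b q -> False.
Proof.
move=> pq; apply: contrapT => hN.
have both n : exists b, [/\ F n b, K b p & K b q].
  apply: contrapT => hn; apply: hN; exists n => m b nm Fb Kp Kq.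
  have [a Fa Kba] := ancestor nm Fb.
  by apply: hn; exists a; split=> //; exact: Kba.
pose deep n a := F n a /\ forall m, (n <= m)%N ->
  exists b, [/\ F m b, K b `<=` K a, K b p & K b q].
have deep0 : deep 0%N (Defs.root S).
  split=> [|m _]; first by rewrite (frc_f0 fr).
  have [b [Fb Kp Kq]] := both m.
  by exists b; split=> //; rewrite (frc_f_root fr).
have deepS n a : deep n a -> exists2 b, deep n.+1 b & K b `<` K a.
  move=> [Fa da]; apply: contrapT => hb.
  have shallow b : exists k, F n.+1 b -> K b `<=` K a -> (n < k)%N /\
      ~ exists c, [/\ F k c, K c `<=` K b, K c p & K c q].
    have [[Fb Kba]|nb] := pselect (F n.+1 b /\ K b `<=` K a); last first.
      by exists 0%N => Fb Kba; case: nb.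
    have nd : ~ deep n.+1 b.
      by move=> db; apply: hb; exists b => //; exact: child_proper Fb Kba.
    apply: contrapT => hk; apply: nd; split=> // m nm.
    by apply: contrapT => hc; apply: hk; exists m.
  have /choice[k kP] := shallow.
  have [M hM] := finite_nat_bound k (frc_f_fin fr n.+1).
  have [c [Fc Kca Kcp Kcq]] := da (maxn n.+1 M) (ltnW (leq_maxl _ _)).
  have [b Fb Kcb] := ancestor (leq_maxl _ _) Fc.
  have Kba := descendant_sub Fa Fb (leqnSn n) Kca Kcb.
  have [nk []] := kP b Fb Kba.
  have [c' Fc' Kcc'] := ancestor (leq_trans (hM b Fb) (leq_maxr n.+1 M)) Fc.
  exists c'; split=> //; [|exact: Kcc'|exact: Kcc'].
  exact: descendant_sub Fb Fc' nk Kcb Kcc'.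
pose next (x y : nat * A) := deep x.1 x.2 ->
  deep y.1 y.2 /\ K y.2 `<` K x.2.
have /dependent_choice : forall x, {y | next x y}.
  move=> x; apply: cid; have [dx|ndx] := pselect (deep x.1 x.2).
    by have [b db bx] := deepS _ _ dx; exists (x.1.+1, b).
  by exists x.
move=> /(_ (0%N, Defs.root S))[s [s0 sP]].
have sdeep n : deep (s n).1 (s n).2.
  by elim: n => [|n IH]; [rewrite s0|have [] := sP n IH].
have [x hx] := frc_h fr (s := fun n => (s n).2) (fun n => (sP n (sdeep n)).2).
have sin n : K (s n).2 p /\ K (s n).2 q.
  have [_ /(_ _ (leqnn _))[b [_ sub bp bq]]] := sdeep n.
  by split; exact: sub.
have px : p = x by apply: hx => n _; have [] := sin n.
have qx : q = x by apply: hx => n _; have [] := sin n.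
by apply: pq; rewrite px qx.
Qed.

Lemma cells_separate_V a : exists N, forall n b p q, (N <= n)%N -> F n b ->
  V a p -> V a q -> K b p -> K b q -> p = q.
Proof.
have /choice[N NP] (pq : T * T) : exists N, pq.1 <> pq.2 ->
    forall n b, (N <= n)%N -> F n b -> K b pq.1 -> K b pq.2 -> False.
  have [h|h] := pselect (pq.1 = pq.2); first by exists 0%N.
  by have [N hN] := cells_separate h; exists N.
have [M hM] := finite_nat_bound N (finite_setX (frc_c_fin fr a) (frc_c_fin fr a)).
exists M => n b p q Mn Fb Vp Vq Kp Kq; apply: contrapT => pq.
by apply: (NP (p, q) pq n b) => //; rewrite (leq_trans (hM (p, q) _)).
Qed.

End Cells.

(** * Energies of cells *)

Section SumsOfForms.
Variables (R : realType) (X : Type).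
Implicit Types q : (X -> R) -> (X -> R) -> R.
Local Notation form q := (QForm setT q).

Lemma psd_scale (c : R) q : 0 <= c -> psd_form (form q) ->
  psd_form (form (fun u v => c * q u v)).
Proof.
move=> c0 pq; split=> //=.
- by move=> u v _ _; congr (_ * _); exact: (psd_sym pq (u:=u) (v:=v) I I).
- move=> a u v w _ _ _.
  by have /= -> := psd_bilin pq a (u:=u) (v:=v) (w:=w) I I I; ring.
- by move=> u _; rewrite mulr_ge0//; exact: (psd_ge0 pq (u:=u) I).
- by move=> k; have /= -> := psd_cst0 pq k; rewrite mulr0.
Qed.

Lemma clip_scale (c : R) q : 0 <= c -> clip_closed (form q) ->
  clip_closed (form (fun u v => c * q u v)).
Proof. by move=> c0 cq u _; split=> //=; rewrite ler_wpM2l// (cq u I).2. Qed.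

Lemma psd_fsum (J : choiceType) (D : set J) (q : J -> (X -> R) -> (X -> R) -> R) :
    finite_set D -> (forall i, D i -> psd_form (form (q i))) ->
  psd_form (form (fun u v => \sum_(i \in D) q i u v)).
Proof.
move=> finD pq; split=> //=.
- move=> u v _ _; apply: eq_fsbigr => i /set_mem Di.
  exact: (psd_sym (pq i Di) (u:=u) (v:=v) I I).
- move=> a u v w _ _ _; rewrite !fsbig_finite// mulr_sumr -big_split /=.
  apply: eq_big_seq => i; rewrite in_fset_set// inE => Di.
  exact: (psd_bilin (pq i Di) a (u:=u) (v:=v) (w:=w) I I I).
- move=> u _; rewrite fsbig_finite// big_seq sumr_ge0// => i.
  by rewrite in_fset_set// inE => Di; exact: (psd_ge0 (pq i Di) (u:=u) I).
- by move=> c; apply: fsbig1 => i Di; exact: (psd_cst0 (pq i Di)).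
Qed.

Lemma ler_fsum_set (J : choiceType) (D : set J) (f g : J -> R) :
  finite_set D -> (forall i, D i -> f i <= g i) ->
  \sum_(i \in D) f i <= \sum_(i \in D) g i.
Proof.
move=> finD fg; rewrite !fsbig_finite// !big_seq ler_sum// => i.
by rewrite in_fset_set// inE => Di; exact: fg.
Qed.

Lemma clip_fsum (J : choiceType) (D : set J) (q : J -> (X -> R) -> (X -> R) -> R) :
    finite_set D -> (forall i, D i -> clip_closed (form (q i))) ->
  clip_closed (form (fun u v => \sum_(i \in D) q i u v)).
Proof.
move=> finD cq u _; split=> //=.
by apply: ler_fsum_set => // i Di; exact: (cq i Di u I).2.
Qed.

Lemma psd_edge (c : R) (x y : X) : 0 <= c ->
  psd_form (form (fun u v => c * (u x - u y) * (v x - v y))).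
Proof.
move=> c0; split=> //=.
- by move=> u v _ _; rewrite -!mulrA; congr (_ * _); exact: mulrC.
- by move=> a u v w _ _ _; rewrite !funE; ring.
- by move=> u _; rewrite -mulrA mulr_ge0// -expr2 sqr_ge0.
- by move=> k; rewrite subrr mulr0.
Qed.

Lemma clip_edge (c : R) (x y : X) : 0 <= c ->
  clip_closed (form (fun u v => c * (u x - u y) * (v x - v y))).
Proof.
move=> c0 u _; split=> //=; rewrite -!mulrA ler_wpM2l// -!expr2.
rewrite -[leLHS]real_normK ?num_real// -[leRHS]real_normK ?num_real//.
rewrite ler_sqr ?nnegrE// /clip.
have cE (s : R) : [\/ s <= 0 /\ Num.min (Num.max 0 s) 1 = 0,
    0 <= s <= 1 /\ Num.min (Num.max 0 s) 1 = s |
    1 <= s /\ Num.min (Num.max 0 s) 1 = 1].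
  have [s0|s0] := leP s 0; first by constructor 1; rewrite (min_idPl ler01).
  have [s1|s1] := leP s 1; first by constructor 2; rewrite (ltW s0).
  by constructor 3; rewrite (ltW s1).
suff lip (s t : R) : s <= t ->
    `|Num.min (Num.max 0 s) 1 - Num.min (Num.max 0 t) 1| <= `|s - t|.
  by have [/lip//|/ltW/lip] := leP (u x) (u y); rewrite distrC [leRHS]distrC.
move=> st; rewrite distrC [leRHS]distrC.
rewrite (ger0_norm (_ : 0 <= t - s)) ?subr_ge0//.
by have [[s0 ->]|[s0 ->]|[s0 ->]] := cE s; have [[t0 ->]|[t0 ->]|[t0 ->]] := cE t;
  rewrite ger0_norm; lra.
Qed.

End SumsOfForms.

Lemma resistance_form_psd (R : realType) (X : Type) (f : qform R X) :
  resistance_form f -> [/\ psd_form f, complete_form f & point_bounded f].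
Proof.
move=> rf; have pf : psd_form f.
  split.
  - exact: rf1_const rf.
  - exact: rf1_lin rf.
  - exact: rf1_sym rf.
  - exact: rf1_bilin rf.
  - exact: rf1_ge0 rf.
  - by move=> c; apply/(rf1_eq0 rf (rf1_const rf c)); exists c.
split=> //; first exact: rf2 rf.
move=> x y; have := rf4 rf x y; case E : (resistance f x y) => [r| |]// _.
  exists r => u fu; have [u0|u0] := ltP 0 (en f u u).
    by have := resistance_ub x y fu u0; rewrite E lee_fin ler_pdivrMr.
  have Q0 : en f u u = 0 by apply/eqP; rewrite eq_le u0 (psd_ge0 pf).
  have [c uE] := (rf1_eq0 rf fu).1 Q0.
  by rewrite Q0 mulr0 uE subrr expr0n.
by have := resistance_ge0 f x y; rewrite E.
Qed.

Section CellEnergies.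
Variables (R : realType) (T A : choiceType) (S : cell_structure R T A).
Hypothesis fr : finitely_ramified S.
Local Notation K := (K_ S).
Local Notation V := (V_ S).
Local Notation F := (filt S).
Implicit Types (a b c : A) (u v : T -> R).

Definition cell_en a u v : R := Ecell (sigL (V a) u) (sigL (V a) v).

Definition subcells a n : set A := [set b | F n b /\ K b `<=` K a].

Definition sub_en a n u v : R := \sum_(b \in subcells a n) cell_en b u v.

Definition level_en n u v : R := \sum_(b \in F n) cell_en b u v.

Lemma finite_subcells a n : finite_set (subcells a n).
Proof. by apply: sub_finite_set (frc_f_fin fr n) => b []. Qed.

Lemma finite_edge a : finite_set (edge S a).
Proof.
have finV : finite_set [set: V a].
  suff -> : [set: V a] = set_val @^-1` V a.
    by apply: finite_preimage (frc_c_fin fr a) => x y _ _; exact: val_inj.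
  by apply/seteqP; split=> // x _; exact: set_valP.
by apply: sub_finite_set (finite_setX finV finV).
Qed.

Lemma psd_cell a : psd_form (QForm setT (cell_en a)).
Proof.
apply: psd_scale; first by rewrite invr_ge0.
apply: (psd_fsum (finite_edge a)) => p _.
by apply: psd_edge; rewrite invr_ge0 fine_ge0// (frc_r_ge0 fr).
Qed.

Lemma clip_cell a : clip_closed (QForm setT (cell_en a)).
Proof.
apply: clip_scale; first by rewrite invr_ge0.
apply: (clip_fsum (finite_edge a)) => p _.
by apply: clip_edge; rewrite invr_ge0 fine_ge0// (frc_r_ge0 fr).
Qed.

Lemma psd_sub a n : psd_form (QForm setT (sub_en a n)).
Proof. by apply: psd_fsum (finite_subcells a n) _ => b _; exact: psd_cell. Qed.

Lemma psd_level n : psd_form (QForm setT (level_en n)).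
Proof. by apply: psd_fsum (frc_f_fin fr n) _ => b _; exact: psd_cell. Qed.

Lemma clip_sub a n : clip_closed (QForm setT (sub_en a n)).
Proof. by apply: clip_fsum (finite_subcells a n) _ => b _; exact: clip_cell. Qed.

Lemma clip_level n : clip_closed (QForm setT (level_en n)).
Proof. by apply: clip_fsum (frc_f_fin fr n) _ => b _; exact: clip_cell. Qed.

Lemma cell_en_local a u u' v v' : (forall x, V a x -> u x = u' x) ->
  (forall x, V a x -> v x = v' x) -> cell_en a u v = cell_en a u' v'.
Proof.
move=> uu' vv'; rewrite /cell_en; congr (Ecell _ _); apply/funext => x /=.
  by apply: uu'; exact: set_valP.
by apply: vv'; exact: set_valP.
Qed.

Lemma sub_en_local a n u u' v v' : (forall x, K a x -> u x = u' x) ->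
  (forall x, K a x -> v x = v' x) -> sub_en a n u v = sub_en a n u' v'.
Proof.
move=> uu' vv'; apply: eq_fsbigr => b /set_mem[_ Kba].
by apply: cell_en_local => x /(V_sub_K fr)/Kba; [exact: uu'|exact: vv'].
Qed.

Lemma level_en_local n u u' v v' : (forall x, Vn S n x -> u x = u' x) ->
  (forall x, Vn S n x -> v x = v' x) -> level_en n u v = level_en n u' v'.
Proof.
move=> uu' vv'; apply: eq_fsbigr => b /set_mem Fb.
by apply: cell_en_local => x Vx; [apply: uu'|apply: vv']; exists b.
Qed.

Lemma sum_sub_en m n (D : set A) u v : D `<=` F m ->
  \sum_(a \in D) sub_en a n u v =
  \sum_(b \in [set b | F n b /\ exists2 a, D a & K b `<=` K a]) cell_en b u v.
Proof.
move=> DF; have finD : finite_set D := sub_finite_set DF (frc_f_fin fr m).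
pose g b a := if b \in [set b | K b `<=` K a] then cell_en b u v else 0.
have -> : \sum_(a \in D) sub_en a n u v = \sum_(a \in D) \sum_(b \in F n) g b a.
  by apply: eq_fsbigr => a _; rewrite -fsbig_mkcondr.
rewrite exchange_fsbig//; last exact: (frc_f_fin fr n).
have -> : [set b | F n b /\ exists2 a, D a & K b `<=` K a] =
    F n `&` [set b | exists2 a, D a & K b `<=` K a] by [].
rewrite fsbig_mkcondr; apply: eq_fsbigr => b /set_mem Fb.
case: ifPn => [/set_mem[a Da Kba]|/negP nD].
  rewrite (fsbigD1 a)//= fsbig1 ?addr0; first by rewrite /g mem_set.
  move=> c [Dc ca]; rewrite /g ifF//; apply/negP => /set_mem Kbc; apply: ca.
  by apply/esym; exact: (ancestor_unique fr (DF _ Da) (DF _ Dc) Kba Kbc).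
apply: fsbig1 => a Da; rewrite /g ifF//; apply/negP => /set_mem Kba.
by apply: nD; apply/mem_set; exists a.
Qed.

Lemma level_en_sum m n u v : (m <= n)%N ->
  level_en n u v = \sum_(a \in F m) sub_en a n u v.
Proof.
move=> mn; rewrite (@sum_sub_en m)//; apply: eq_fsbigl; apply/seteqP.
by split=> [b Fb|b []//]; split=> //; exact: ancestor Fb.
Qed.

Lemma sub_en_sum k m n a u v : F k a -> (k <= m)%N -> (m <= n)%N ->
  sub_en a n u v = \sum_(b \in subcells a m) sub_en b n u v.
Proof.
move=> Fa km mn; rewrite (@sum_sub_en m); last by move=> b [].
apply: eq_fsbigl; apply/seteqP; split=> b [Fb].
  move=> Kba; split=> //; have [c Fc Kbc] := ancestor fr mn Fb.
  by exists c => //; split=> //; exact: (descendant_sub fr Fa Fc km Kba Kbc).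
by move=> [c [_ Kca] Kbc]; split=> //; exact: subset_trans Kca.
Qed.

Lemma sub_en_le_level a n u : sub_en a n u u <= level_en n u u.
Proof.
rewrite /level_en (fsbigID (subcells a n) _ _ (frc_f_fin fr n)).
have -> : F n `&` subcells a n = subcells a n.
  by apply/seteqP; split=> b [] // Fb Kba; split.
have finD : finite_set (F n `&` ~` subcells a n).
  by apply: sub_finite_set (frc_f_fin fr n) => b [].
rewrite lerDl (fsbig_finite _ _ finD) sumr_ge0// => b _.
exact: (psd_ge0 (psd_cell b) (u:=u) I).
Qed.

End CellEnergies.

(** * Harmonic structures: monotonicity inside a cell *)

Section Harmonic.
Variables (R : realType) (T A : choiceType) (S : cell_structure R T A).
Hypotheses (fr : finitely_ramified S) (hs : harmonic_structure S).
Local Notation K := (K_ S).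
Local Notation V := (V_ S).
Local Notation F := (filt S).
Implicit Types (a b : A) (u v phi chi : T -> R).

Lemma En_level n u v :
  En (sigL (Vn S n) u) (sigL (Vn S n) v) = level_en S n u v.
Proof.
apply: level_en_local => x Vx;
  by rewrite -[LHS]/(('valL_0 \o sigL (Vn S n)) _ x) sigLK patchT// mem_set.
Qed.

Lemma level_extension n phi : exists psi,
  [/\ forall x, Vn S n x -> psi x = phi x,
      level_en S n.+1 psi psi = level_en S n phi phi &
      forall chi, (forall x, Vn S n x -> chi x = phi x) ->
        level_en S n.+1 psi psi <= level_en S n.+1 chi chi].
Proof.
have [pf cf bf] := resistance_form_psd (hs.1 n.+1).
pose j (y : Vn S n) : Vn S n.+1 := SigSub (mem_set (VnS fr (set_valP y))).
have restrE : restr (Vn S n) = (fun u : Vn S n.+1 -> R => u \o j).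
  apply/funext => u; apply/funext => y /=; rewrite /restr /=.
  have jy : set_val y = set_val (j y) by [].
  rewrite jy; exact: (congr1 (@^~ (j y)) (valLK 0 u)).
have [x0 Vx0] := Vn_point fr n.
have [v [_ vphi vE vmin]] := trace_form_min j pf (SigSub (mem_set Vx0)) cf bf
  (u0 := sigL (Vn S n.+1) phi) I.
pose psi := 'valL_0 v : T -> R.
have psiE : sigL (Vn S n.+1) psi = v by exact: valLK.
have phiE u : sigL (Vn S n.+1) u \o j = sigL (Vn S n) u by [].
have psiphi x : Vn S n x -> psi x = phi x.
  move=> Vx; have := congr1 (@^~ (SigSub (mem_set Vx))) vphi.
  by rewrite -psiE.
exists psi; split=> //.
- have trE : En (sigL (Vn S n) phi) (sigL (Vn S n) phi) =
      en (trace_form (restr (Vn S n)) (En_form S n.+1))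
        (sigL (Vn S n) phi) (sigL (Vn S n) phi) := (hs.2 n).2 _ _ I I.
  by rewrite -!En_level psiE trE restrE; exact: vE.
- move=> chi chiphi; rewrite -!En_level psiE.
  apply: (vmin (sigL (Vn S n.+1) chi) I).
  apply/funext => y; apply: (chiphi (set_val y)); exact: set_valP.
Qed.

Lemma level_en_le m n u : (m <= n)%N -> level_en S m u u <= level_en S n u u.
Proof.
move=> /subnK <-; elim: (n - m)%N => [//|k IH]; rewrite addSn (le_trans IH)//.
have [psi [_ <- psimin]] := level_extension (k + m) u; exact: psimin.
Qed.

Definition ext n : (T -> R) -> T -> R := fun phi =>
  projT1 (cid (level_extension n phi)).

Lemma extE n phi x : Vn S n x -> ext n phi x = phi x.
Proof. by rewrite /ext; case: cid => psi [h _ _] /= Vx; exact: h. Qed.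

Lemma ext_level n phi :
  level_en S n.+1 (ext n phi) (ext n phi) = level_en S n phi phi.
Proof. by rewrite /ext; case: cid => psi []. Qed.

Lemma ext_level_min n phi chi : (forall x, Vn S n x -> chi x = phi x) ->
  level_en S n.+1 (ext n phi) (ext n phi) <= level_en S n.+1 chi chi.
Proof. by rewrite /ext; case: cid => psi [_ _ h] /=; exact: h. Qed.

(** The extension with least energy at the next level has least energy in each
    cell, as competitors inside different cells can be glued. *)
Lemma ext_cell_min n b phi chi : F n b -> (forall x, V b x -> chi x = phi x) ->
  sub_en S b n.+1 (ext n phi) (ext n phi) <= sub_en S b n.+1 chi chi.
Proof.
move=> Fb chiphi; pose g := patch (ext n phi) (K b) chi.
have gK x : K b x -> g x = chi x by move=> Kx; rewrite /g patchT// mem_set.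
have gN x : ~ K b x -> g x = ext n phi x.
  by move=> Kx; rewrite /g patchN//; apply/negP => /set_mem.
have gphi x : Vn S n x -> g x = phi x.
  move=> Vx; have [Kx|Kx] := pselect (K b x); last by rewrite gN// extE.
  by rewrite gK// chiphi//; exact: (Vn_cell fr Fb).
have := ext_level_min gphi; rewrite !(level_en_sum fr _ _ (leqnSn n)).
rewrite !(fsbigD1 b (F n))//=; try exact: (frc_f_fin fr n).
have -> : sub_en S b n.+1 g g = sub_en S b n.+1 chi chi by apply: sub_en_local.
have -> : \sum_(a \in F n `\ b) sub_en S a n.+1 g g =
    \sum_(a \in F n `\ b) sub_en S a n.+1 (ext n phi) (ext n phi).
  apply: eq_fsbigr => a /set_mem[Fa ab].
  suff ge x : K a x -> g x = ext n phi x by apply: sub_en_local.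
  move=> Kax; have [Kx|/gN//] := pselect (K b x).
  have [Vax Vbx] := K_cap_V fr Fa Fb ab Kax Kx.
  by rewrite gphi ?extE//; exists b.
by rewrite lerD2r.
Qed.

(** The energy of [b] need not be the trace of the energy inside [b] at the next
    level: harmonicity only says that the excesses of all the cells of a level
    add up to zero, and energy may move between cells that share several
    vertices. *)
Definition excess n b phi : R :=
  sub_en S b n.+1 (ext n phi) (ext n phi) - cell_en S b phi phi.

Lemma excess_sum n phi : \sum_(b \in F n) excess n b phi = 0.
Proof.
rewrite (fsbig_finite _ _ (frc_f_fin fr n)) /excess /= sumrB.
rewrite -!(fsbig_finite _ _ (frc_f_fin fr n)).
by rewrite -(level_en_sum fr)// ext_level subrr.
Qed.

Lemma excess_le n b phi chi : F n b -> (forall x, V b x -> chi x = phi x) ->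
  excess n b phi <= sub_en S b n.+1 chi chi - cell_en S b phi phi.
Proof. by move=> Fb chiphi; rewrite lerB// ext_cell_min. Qed.

Lemma excess_local n b phi phi' : F n b -> (forall x, V b x -> phi x = phi' x) ->
  excess n b phi = excess n b phi'.
Proof.
move=> Fb e; have Vbn x : V b x -> Vn S n x by exists b.
have ce := cell_en_local e e; apply/eqP; rewrite eq_le; apply/andP; split.
  rewrite /excess -ce; apply: excess_le => // x Vx.
  by rewrite extE ?e//; exact: Vbn.
rewrite /excess ce; apply: excess_le => // x Vx.
by rewrite extE ?e//; exact: Vbn.
Qed.

Lemma excess_addcst n b phi c : F n b ->
  excess n b (phi + (fun=> c)) = excess n b phi.
Proof.
move=> Fb; have Vbn x : V b x -> Vn S n x by exists b.
have le psi d : excess n b (psi + (fun=> d)) <= excess n b psi.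
  have -> : excess n b psi =
      sub_en S b n.+1 (ext n psi + (fun=> d)) (ext n psi + (fun=> d))
      - cell_en S b (psi + (fun=> d)) (psi + (fun=> d)).
    have /= -> := @en_addcst _ _ _ (psd_sub fr b n.+1) (ext n psi) d I.
    by have /= -> := @en_addcst _ _ _ (psd_cell fr b) psi d I.
  by apply: excess_le => // x Vx; rewrite !funE extE//; exact: Vbn.
apply/eqP; rewrite eq_le le /=.
have {1}-> : phi = phi + (fun=> c) + (fun=> - c).
  by apply/funext => x; rewrite !funE addrK.
exact: le.
Qed.

Lemma excess_scale n b phi t : F n b ->
  excess n b (t *: phi) = t ^+ 2 * excess n b phi.
Proof.
move=> Fb; have Vbn x : V b x -> Vn S n x by exists b.
have le psi d : excess n b (d *: psi) <= d ^+ 2 * excess n b psi.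
  have -> : d ^+ 2 * excess n b psi =
      sub_en S b n.+1 (d *: ext n psi) (d *: ext n psi)
      - cell_en S b (d *: psi) (d *: psi).
    have /= -> := @en_scale _ _ _ (psd_sub fr b n.+1) d (ext n psi) I.
    by have /= -> := @en_scale _ _ _ (psd_cell fr b) d psi I; rewrite mulrBr.
  by apply: excess_le => // x Vx; rewrite !funE extE//; exact: Vbn.
have [->|t0] := eqVneq t 0.
  rewrite expr0n mul0r scale0r; have := le 0 0; rewrite scale0r expr0n mul0r => h.
  apply/eqP; rewrite eq_le h /excess.
  have /= -> := @en0l _ _ _ (psd_cell fr b) 0 I.
  by rewrite subr0; exact: (psd_ge0 (psd_sub fr b n.+1) (u := ext n 0) I).
apply/eqP; rewrite eq_le le /=.
have := le (t *: phi) t^-1; rewrite scalerA mulVf// scale1r exprVn.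
by rewrite ler_pdivlMl// exprn_even_gt0.
Qed.

Definition point_mass (p : T) : T -> R := fun x => (x == p)%:R.

(** At levels where no cell contains two vertices of [a], no energy moves into
    or out of [a]. The total excess inside [a] depends on the values on [V a]
    alone, as it can be computed outside of [a], and there it is the sum of the
    contributions s_p phi(p)^2 of single vertices. Since constants can be added
    to phi, all the s_p are zero. *)
Lemma excess_cell_eq0 m a : F m a -> exists2 N, (m <= N)%N &
  forall n, (N <= n)%N -> forall phi,
    \sum_(b \in subcells S a n) excess n b phi = 0.
Proof.
move=> Fa; have [N sepN] := cells_separate_V fr a.
exists (maxn m N) => [|n]; first exact: leq_maxl.
rewrite geq_max => /andP[mn Nn].
have finD := finite_subcells fr a n; have finV := frc_c_fin fr a.
have subF b : subcells S a n b -> F n b by case.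
pose G phi := \sum_(b \in subcells S a n) excess n b phi.
pose s p := G (point_mass p).
have Gloc phi phi' : (forall x, K a x -> phi x = phi' x) -> G phi = G phi'.
  move=> e; apply: eq_fsbigr => b /set_mem[Fb Kba].
  by apply: excess_local => // x /(V_sub_K fr)/Kba/e.
have Gout phi phi' : (forall x, ~ (K a `\` V a) x -> phi x = phi' x) ->
    G phi = G phi'.
  move=> e.
  have GE psi : G psi = - \sum_(b \in F n `&` ~` subcells S a n) excess n b psi.
    apply/eqP; rewrite -addr_eq0 -[X in _ == X](excess_sum n psi).
    rewrite (fsbigID (subcells S a n) _ _ (frc_f_fin fr n)).
    have -> : F n `&` subcells S a n = subcells S a n.
      by apply/seteqP; split=> b [] // Fb Kba; split.
    exact: eqxx.
  rewrite !GE; congr (- _); apply: eq_fsbigr => b /set_mem[Fb Nb].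
  apply: excess_local => // x /(V_sub_K fr) Kbx; apply: e => -[Kax nVax].
  have [c Fc Kbc] := ancestor fr mn Fb.
  have [ca|ca] := pselect (c = a); first by apply: Nb; rewrite -ca.
  by have [_ /nVax] := K_cap_V fr Fc Fa ca (Kbc _ Kbx) Kax.
have Gsum phi : G phi = \sum_(p \in V a) phi p ^+ 2 * s p.
  pose phi1 := patch (fun=> 0) (K a) phi.
  pose phi2 := patch (fun=> 0) (V a) phi.
  have -> : G phi = G phi2.
    transitivity (G phi1).
      by apply: Gloc => x Kx; rewrite /phi1 patchT// mem_set.
    apply: Gout => x nx; rewrite /phi1 /phi2.
    have [Vx|nVx] := pselect (V a x).
      have Kx := V_sub_K fr Vx.
      by rewrite !patchT ?mem_set.
    have nKx : ~ K a x by move=> Kx; apply: nx.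
    by rewrite !patchN//; apply/negP => /set_mem.
  have -> : \sum_(p \in V a) phi p ^+ 2 * s p =
      \sum_(p \in V a) \sum_(b \in subcells S a n)
        phi p ^+ 2 * excess n b (point_mass p).
    by apply: eq_fsbigr => p _; rewrite /s /G !fsbig_finite// mulr_sumr.
  rewrite exchange_fsbig//; apply: eq_fsbigr => b /set_mem[Fb Kba].
  have pm0 p : ~ V b p -> excess n b (point_mass p) = 0.
    move=> nVp; rewrite (@excess_local _ _ _ (0 *: point_mass p))//.
      by rewrite excess_scale// expr0n mul0r.
    move=> x Vx; rewrite scalefE mul0r /point_mass.
    by case: eqP => // xp; case: nVp; rewrite -xp.
  have sep p q : V a p -> V a q -> V b p -> V b q -> p = q.
    by move=> Vp Vq /(V_sub_K fr) + /(V_sub_K fr); exact: sepN Fb Vp Vq.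
  have [[p [Vap Vbp]]|none] := pselect (exists p, V a p /\ V b p); last first.
    rewrite fsbig1 => [|p Vap]; last first.
      by rewrite pm0 ?mulr0// => Vbp; apply: none; exists p.
    rewrite (@excess_local _ _ _ (0 *: phi2))//.
      by rewrite excess_scale// expr0n mul0r.
    move=> x Vbx; rewrite scalefE mul0r /phi2 patchN//.
    by apply/negP => /set_mem Vax; apply: none; exists x.
  rewrite (fsbigD1 p)//= fsbig1 ?addr0 => [|q [Vaq qp]]; last first.
    by rewrite pm0 ?mulr0// => Vbq; apply: qp; exact: sep.
  rewrite -excess_scale//; apply: excess_local => // x Vbx.
  rewrite scalefE /point_mass /phi2; case: eqP => [->|xp].
    by rewrite mulr1 patchT// mem_set.
  rewrite mulr0 patchN//; apply/negP => /set_mem Vax; apply: xp; exact: sep.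
have Gcst phi c : G (phi + (fun=> c)) = G phi.
  by apply: eq_fsbigr => b /set_mem[Fb _]; exact: excess_addcst.
have ssum : \sum_(p \in V a) s p = 0.
  transitivity (G (0 + (fun=> 1))).
    by rewrite Gsum; apply: eq_fsbigr => p _; rewrite addfE add0r expr1n mul1r.
  by rewrite Gcst Gsum fsbig1// => p _; rewrite expr0n mul0r.
have s0 p : V a p -> s p = 0.
  move=> Vp; have := Gcst (point_mass p) 1.
  rewrite -[RHS]/(s p) Gsum; move: ssum.
  rewrite (fsbigD1 p (V a) _ finV Vp) [in X in _ -> X](fsbigD1 p (V a) _ finV Vp) /=.
  rewrite addfE /point_mass eqxx.
  have -> : \sum_(q \in V a `\ p) (point_mass p + (fun=> 1)) q ^+ 2 * s q =
      \sum_(q \in V a `\ p) s q.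
    apply: eq_fsbigr => q /set_mem[_ /eqP/negbTE qp].
    by rewrite addfE /point_mass qp add0r expr1n mul1r.
  by rewrite /=; lra.
move=> phi; rewrite -[LHS]/(G phi) Gsum fsbig1// => p Vp.
by rewrite s0// mulr0.
Qed.

Lemma sub_en_mono a : exists N, forall n, (N <= n)%N -> forall u,
  sub_en S a n u u <= sub_en S a n.+1 u u.
Proof.
have [m Fa] := level_of fr a; have [N mN exN] := excess_cell_eq0 Fa.
exists N => n Nn u; have mn := leq_trans mN Nn.
rewrite (sub_en_sum fr _ _ Fa mn (leqnSn n)).
have finD := finite_subcells fr a n.
rewrite -subr_ge0 -[leLHS](exN n Nn u).
have -> : sub_en S a n u u = \sum_(b \in subcells S a n) cell_en S b u u by [].
rewrite !(fsbig_finite _ _ finD) /= -sumrB -!(fsbig_finite _ _ finD).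
apply: ler_fsum_set => // b [Fb _].
by apply: excess_le.
Qed.

End Harmonic.

(** * The resistance form and its restrictions to cells *)

Lemma fsum_cvg (R : realType) (J : choiceType) (D : set J)
    (f : nat -> J -> R) (l : J -> R) : finite_set D ->
    (forall i, D i -> f k i @[k --> \oo] --> l i) ->
  \sum_(i \in D) f k i @[k --> \oo] --> \sum_(i \in D) l i.
Proof.
move=> finD fl; rewrite (fsbig_finite _ _ finD) big_seq.
have -> : (fun k => \sum_(i \in D) f k i) =
    (fun k => \sum_(i <- fset_set D | i \in fset_set D) f k i).
  by apply/funext => k; rewrite (fsbig_finite _ _ finD) big_seq.
apply: cvg_big; first exact: add_continuous.
by move=> i; rewrite in_fset_set// inE; exact: fl.
Qed.

Section EnergyForms.
Variables (R : realType) (T A : choiceType) (S : cell_structure R T A).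
Hypotheses (fr : finitely_ramified S) (hs : harmonic_structure S).
Local Notation K := (K_ S).
Local Notation V := (V_ S).
Local Notation F := (filt S).
Local Notation E := (E_form S).
Implicit Types (a b : A) (u v phi chi : T -> R).

(** The restriction of the form to [K a], as a form on functions on the whole
    space that only sees their values on [K a]. *)
Definition cell_form a : qform R T := lim_form (sub_en S a).

Lemma E_formE : E = lim_form (level_en S).
Proof.
rewrite /E_form /lim_form; congr QForm.
  by apply/funext => u /=; under eq_fun do rewrite En_level.
by apply/funext => u; apply/funext => v; under eq_fun do rewrite En_level.
Qed.

Lemma level_mono n : (0 <= n)%N ->
  forall u, level_en S n u u <= level_en S n.+1 u u.
Proof. by move=> _ u; exact: (level_en_le fr hs). Qed.

Lemma psd_E : psd_form E.
Proof. by rewrite E_formE; exact: (psd_lim_form (psd_level fr) level_mono). Qed.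

Lemma clip_E : clip_closed E.
Proof.
by rewrite E_formE; exact: (clip_lim_form level_mono (clip_level fr)).
Qed.

Lemma psd_cell_form a : psd_form (cell_form a).
Proof.
have [N monoN] := sub_en_mono fr hs a.
exact: (psd_lim_form (psd_sub fr a) monoN).
Qed.

Lemma clip_cell_form a : clip_closed (cell_form a).
Proof.
have [N monoN] := sub_en_mono fr hs a.
exact: (clip_lim_form monoN (fun n => @clip_sub _ _ _ S fr a n)).
Qed.

Lemma level_le_E n u : dom E u -> level_en S n u u <= en E u u.
Proof. by rewrite E_formE => Eu; exact: (lim_en_ge level_mono). Qed.

Lemma E_le u C : (forall n, level_en S n u u <= C) -> dom E u /\ en E u u <= C.
Proof. by rewrite E_formE => h; apply: (lim_en_le level_mono) => n _. Qed.

Lemma level_cvg_E u : dom E u -> level_en S n u u @[n --> \oo] --> en E u u.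
Proof. by rewrite E_formE; exact: (lim_cvg_diag level_mono). Qed.

Lemma dom_cell_form a u : dom E u -> dom (cell_form a) u.
Proof.
move=> Eu; have [N monoN] := sub_en_mono fr hs a.
apply/(lim_domP monoN); exists (en E u u) => n _.
exact: le_trans (sub_en_le_level fr a n u) (level_le_E n Eu).
Qed.

Lemma cell_form_le a u : dom E u -> en (cell_form a) u u <= en E u u.
Proof.
move=> Eu; have [N monoN] := sub_en_mono fr hs a.
apply: (lim_en_le monoN _).2 => n _.
exact: le_trans (sub_en_le_level fr a n u) (level_le_E n Eu).
Qed.

Lemma cell_form_local a u v : (forall x, K a x -> u x = v x) ->
  (dom (cell_form a) u -> dom (cell_form a) v) /\
  en (cell_form a) u u = en (cell_form a) v v.
Proof.
move=> uv; have sE n : sub_en S a n u u = sub_en S a n v v by exact: sub_en_local.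
split; last by rewrite /=; under eq_fun do rewrite sE.
by rewrite /=; under eq_fun do rewrite sE.
Qed.

Lemma E_sum_cells m u : dom E u ->
  en E u u = \sum_(a \in F m) en (cell_form a) u u.
Proof.
move=> Eu; apply: (cvg_unique _ (level_cvg_E Eu)) => //.
apply: (@cvg_trans _ ((fun n => \sum_(a \in F m) sub_en S a n u u) @ \oo)).
  apply: near_eq_cvg; near=> n; rewrite -level_en_sum//.
  by near: n; exact: nbhs_infty_ge.
apply: fsum_cvg (frc_f_fin fr m) _ => a _.
have [N monoN] := sub_en_mono fr hs a.
exact: (lim_cvg_diag monoN (dom_cell_form a Eu)).
Unshelve. all: by end_near. Qed.

Lemma glue_dom m u : (forall a, F m a -> dom (cell_form a) u) -> dom E u.
Proof.
move=> du; have /choice[C hC] (a : A) : exists CN : R * nat, F m a ->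
    forall n, (CN.2 <= n)%N -> sub_en S a n u u <= CN.1.
  have [Fa|nFa] := pselect (F m a); last by exists (0, 0%N).
  have [N monoN] := sub_en_mono fr hs a.
  by have /(lim_domP monoN)[C hC] := du a Fa; exists (C, N).
have [M hM] := finite_nat_bound (fun a => (C a).2) (frc_f_fin fr m).
apply: (E_le (C := \sum_(a \in F m) (C a).1) _).1 => n.
pose n' := maxn n (maxn m M).
rewrite (le_trans (level_en_le fr hs u (leq_maxl n (maxn m M))))// -/n'.
rewrite (level_en_sum fr _ _ (_ : m <= n')%N); last first.
  by rewrite /n' !leq_max leqnn orbT.
apply: ler_fsum_set (frc_f_fin fr m) _ => a Fa; apply: hC => //.
by rewrite (leq_trans (hM a Fa))// /n' !leq_max leqnn !orbT.
Qed.

(** Iterating the extension with least energy does not change the energy. *)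
Lemma energy_extension n phi : exists h, dom E h /\
  forall x, Vn S n x -> h x = phi x.
Proof.
pose h := fix h k := if k is k'.+1 then ext fr hs (k' + n) (h k') else phi.
have hS k x : Vn S (k + n) x -> h k.+1 x = h k x by exact: extE.
have hE k j x : Vn S (k + n) x -> h (j + k)%N x = h k x.
  move=> Vx; elim: j => // j IH; rewrite addSn hS//.
  by apply: (Vn_le fr) Vx; rewrite leq_add2r leq_addl.
have /choice[l lP] x : exists l, Vn S (l + n) x.
  by have [l Vx] := Vn_cover fr x; exists l; apply: (Vn_le fr) Vx; exact: leq_addr.
pose h_ x := h (l x) x.
have h_E k x : Vn S (k + n) x -> h_ x = h k x.
  move=> Vx; rewrite /h_ -(hE _ k _ (lP x)) -(hE _ (l x) _ Vx).
  by rewrite addnC.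
have hen k : level_en S (k + n) (h k) (h k) = level_en S n phi phi.
  by elim: k => // k IH; rewrite addSn ext_level.
exists h_; split=> [|x Vx]; last exact: (h_E 0%N).
apply: (E_le (C := level_en S n phi phi) _).1 => k.
rewrite (le_trans (level_en_le fr hs h_ (leq_addr n k)))//.
by rewrite (level_en_local (h_E k) (h_E k)) hen.
Qed.

(** Energy inside [K a] can be extended to the whole space, since [K a] meets
    the other cells of its level in [V a] only. *)
Lemma cell_extension a u : dom (cell_form a) u ->
  exists2 w, dom E w & forall x, K a x -> w x = u x.
Proof.
move=> du; have [m Fa] := level_of fr a.
have [h [Eh hu]] := energy_extension m u.
pose w := patch h (K a) u.
have wK x : K a x -> w x = u x by move=> Kx; rewrite /w patchT// mem_set.
exists w => //; apply: (@glue_dom m) => b Fb.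
have [ba|ba] := pselect (b = a).
  by rewrite ba; apply: (cell_form_local (a := a) (u := u) _).1 => // x /wK.
apply: (cell_form_local (a := b) (u := h) _).1; last exact: dom_cell_form.
move=> x Kbx; have [Kax|nKax] := pselect (K a x); last first.
  by rewrite /w patchN//; apply/negP => /set_mem.
have [_ Vax] := K_cap_V fr Fb Fa ba Kbx Kax.
by rewrite wK// hu//; exists a.
Qed.

Lemma E_point_bounded : point_bounded E.
Proof.
move=> x y; have [n [Vx Vy]] : exists n, Vn S n x /\ Vn S n y.
  have [i Vx] := Vn_cover fr x; have [j Vy] := Vn_cover fr y.
  exists (maxn i j); split; [apply: (Vn_le fr) Vx|apply: (Vn_le fr) Vy].
    exact: leq_maxl.
  exact: leq_maxr.
have [_ _ bf] := resistance_form_psd (hs.1 n).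
have [C hC] := bf (SigSub (mem_set Vx)) (SigSub (mem_set Vy)).
exists `|C| => u Eu; have := hC (sigL (Vn S n) u) I.
rewrite /= En_level => /le_trans; apply.
apply: (@le_trans _ _ (`|C| * level_en S n u u)).
  by rewrite ler_wpM2r ?ler_norm//; exact: (psd_ge0 (psd_level fr n) (u:=u) I).
by rewrite ler_wpM2l// level_le_E.
Qed.

Lemma cell_en_cvg a (w : nat -> T -> R) u :
    (forall x, w k x @[k --> \oo] --> u x) ->
  cell_en S a (w k) (w k) @[k --> \oo] --> cell_en S a u u.
Proof.
move=> wu; rewrite /cell_en /Ecell; apply: cvgM; first exact: cvg_cst.
apply: fsum_cvg (finite_edge fr a) _ => p _ /=.
by apply: cvgM; [apply: cvgM; [exact: cvg_cst|]|]; apply: cvgB.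
Qed.

(** Completeness: energies are lower semicontinuous under pointwise
    convergence, and a Cauchy sequence that is normalized at one point
    converges pointwise. *)
Lemma E_complete : complete_form E.
Proof.
move=> u Eu cau; have [x0 _] := Vn_point fr 0.
pose w k := u k + (fun=> - u k x0).
have Ew k : dom E (w k) by apply: (domD psd_E) => //; exact: (psd_cst psd_E).
have wE k l : en E (w k - w l) (w k - w l) = en E (u k - u l) (u k - u l).
  have -> : w k - w l = u k - u l + (fun=> u l x0 - u k x0).
    by apply/funext => x; rewrite /w !funE; ring.
  exact: (en_addcst psd_E _ (domB psd_E (Eu k) (Eu l))).
have w0 k : w k x0 = 0 by rewrite /w addfE subrr.
have wcv x : cvg (w k x @[k --> \oo]).
  have [C hC] := E_point_bounded x x0.
  apply/cauchy_cvgP; apply: cauchy_exP => e e0.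
  have d0 : 0 < e ^+ 2 / (`|C| + 1) by rewrite divr_gt0 ?exprn_gt0// ltr_wpDl.
  have [N hN] := cau _ d0; exists (w N x).
  exists N => // k /= Nk; rewrite -ball_normE /ball_ /=.
  rewrite -ltr_sqr ?nnegrE ?(ltW e0)// real_normK ?num_real//.
  have := hC _ (domB psd_E (Ew N) (Ew k)).
  rewrite !funE !w0 !subr0 => /le_lt_trans; apply; rewrite wE.
  have := hN N k (leqnn _) Nk; rewrite ltr_pdivlMr; last by rewrite ltr_wpDl.
  have := psd_ge0 psd_E (domB psd_E (Eu N) (Eu k)).
  set q := en E _ _ => q0 hq; apply: le_lt_trans hq.
  rewrite mulrC ler_wpM2l//; have := ler_norm C; lra.
pose v x := lim (w k x @[k --> \oo]).
have wv e : 0 < e -> exists N, forall k, (N <= k)%N ->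
    dom E (w k - v) /\ en E (w k - v) (w k - v) <= e.
  move=> e0; have [N hN] := cau e e0; exists N => k Nk; apply: E_le => n.
  have cv : level_en S n (w k - w l) (w k - w l) @[l --> \oo] -->
      level_en S n (w k - v) (w k - v).
    apply: fsum_cvg (frc_f_fin fr n) _ => a _; apply: cell_en_cvg => x.
    by apply: cvgB; [exact: cvg_cst|exact: wcv].
  apply: (cvgr_to_le cv); exists N => // l /= Nl.
  rewrite (le_trans (level_le_E n (domB psd_E (Ew k) (Ew l))))// wE.
  by apply: ltW; exact: hN.
have Ev : dom E v.
  have [N hN] := wv 1 ltr01; have [EN _] := hN N (leqnn N).
  by rewrite -[v](subKr (w N)); exact: (domB psd_E).
exists v => //; apply/cvgrPdist_le => e e0; have [N hN] := wv e e0.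
exists N => // k Nk; change (`|0 - en E (u k - v) (u k - v)| <= e).
rewrite sub0r normrN.
have -> : en E (u k - v) (u k - v) = en E (w k - v) (w k - v).
  have -> : w k - v = u k - v + (fun=> - u k x0).
    by apply/funext => x; rewrite /w !funE; ring.
  by rewrite (en_addcst psd_E _ (domB psd_E (Eu k) Ev)).
rewrite ger0_norm; first exact: (hN k Nk).2.
exact: (psd_ge0 psd_E (domB psd_E (Ew k) Ev)).
Qed.

Lemma E_gt0 u x y : dom E u -> u x <> u y -> 0 < en E u u.
Proof.
move=> Eu uxy; rewrite lt_neqAle (psd_ge0 psd_E Eu) andbT; apply/eqP => Q0.
have [C /(_ u Eu)] := E_point_bounded x y; rewrite -Q0 mulr0 => h.
by apply: uxy; apply/eqP; rewrite -subr_eq0 -sqrf_eq0 eq_le h sqr_ge0.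
Qed.

Lemma level_gt0 n u x y : Vn S n x -> Vn S n y -> u x <> u y ->
  0 < level_en S n u u.
Proof.
move=> Vx Vy uxy.
have Q0 := psd_ge0 (psd_level fr n) (u:=u) I.
rewrite lt_neqAle Q0 andbT; apply/eqP => Qu0.
have [_ _ bf] := resistance_form_psd (hs.1 n).
have [C hC] := bf (SigSub (mem_set Vx)) (SigSub (mem_set Vy)).
have := hC (sigL (Vn S n) u) I; rewrite /= En_level -Qu0 mulr0 => h.
by apply: uxy; apply/eqP; rewrite -subr_eq0 -sqrf_eq0 eq_le h sqr_ge0.
Qed.

(** A point of [K a] that is not a vertex of [a] belongs to no other cell of
    the same level, hence its connections to the rest of the space provide
    energy inside [K a]. *)
Lemma cell_form_gt0 a : exists2 z, dom (cell_form a) z & 0 < en (cell_form a) z z.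
Proof.
have [x Kax nVax] := K_interior fr a.
have [y [_ [Vay _ _]]] := frc_c_two fr a.
have yx : y <> x by move=> yx; apply: nVax; rewrite -yx.
have [m Fa] := level_of fr a; have [N monoN] := sub_en_mono fr hs a.
have [i Vx] := Vn_cover fr x.
pose n := maxn (maxn m i) N.
have [mn ni Nn] : [/\ (m <= n)%N, (i <= n)%N & (N <= n)%N].
  by rewrite /n !leq_max !leqnn !orbT.
have Vnx := Vn_le fr ni Vx.
have Vny : Vn S n y by apply: (Vn_le fr mn); exists a.
have [h [Eh hE]] := energy_extension n (point_mass R x).
have dh := dom_cell_form a Eh; exists h => //.
apply: lt_le_trans (lim_en_ge monoN dh Nn).
have -> : sub_en S a n h h = sub_en S a n (point_mass R x) (point_mass R x).
  by apply: eq_fsbigr => b /set_mem[Fb _];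
    apply: cell_en_local => z Vz; apply: hE; exists b.
suff <- : level_en S n (point_mass R x) (point_mass R x) =
          sub_en S a n (point_mass R x) (point_mass R x).
  apply: (level_gt0 Vnx Vny); rewrite /point_mass eqxx.
  by case: eqP => // _; apply/eqP; rewrite oner_eq0.
rewrite (level_en_sum fr _ _ mn) (fsbigD1 a _ _ (frc_f_fin fr m) Fa) /=.
rewrite fsbig1 ?addr0// => b [Fb ba].
have pm0 z : K b z -> point_mass R x z = (0 : T -> R) z.
  move=> Kbz; rewrite /point_mass; case: eqP => // zx; case: nVax.
  by rewrite zx in Kbz; have [] := K_cap_V fr Fb Fa ba Kbz Kax.
rewrite (sub_en_local fr n pm0 pm0).
exact: (en0l (psd_sub fr b n) (w := 0) I).
Qed.

End EnergyForms.

(** * The form generated by functions that are constant on marked cells *)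

Section Tilde.
Variables (R : realType) (T A : choiceType) (S : cell_structure R T A).
Variable At : nat -> set A.
Hypotheses (fr : finitely_ramified S) (hs : harmonic_structure S).
Hypothesis A1 : assumption_A1 S At.
Local Notation K := (K_ S).
Local Notation V := (V_ S).
Local Notation F := (filt S).
Local Notation E := (E_form S).
Local Notation Ft := (Ftilde S At).
Local Notation Ft_n := (Ftilde_n S At).
Local Notation psdE := (psd_E fr hs).
Implicit Types (a b : A) (u v w : T -> R).

(** A linear space, because the marked cells are nested. *)
Definition flat : set (T -> R) := \bigcup_(n in [set n | (1 <= n)%N]) Ft_n n.

Lemma Ftilde_nS n u : Ft_n n u -> Ft_n n.+1 u.
Proof.
have [_ A1S _] := A1; move=> [Eu cu]; split=> // a Aa x y Kx Ky.
by have [b Ab Kab] := A1S _ _ Aa; apply: (cu b) => //; exact: Kab.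
Qed.

Lemma Ftilde_n_le m n u : (m <= n)%N -> Ft_n m u -> Ft_n n u.
Proof.
by move=> /subnK <-; elim: (n - m)%N => // k IH /IH; exact: Ftilde_nS.
Qed.

Lemma Ftilde_n_flat n u : Ft_n n u -> flat u.
Proof. by move=> fu; exists n.+1 => //; exact: Ftilde_nS. Qed.

Lemma flat_dom : flat `<=` dom E.
Proof. by move=> u [n _ []]. Qed.

Lemma flat_cst c : flat (fun=> c).
Proof. by exists 1%N => //; split=> //; exact: (psd_cst psdE). Qed.

Lemma flat_lin k u v : flat u -> flat v -> flat (k *: u + v).
Proof.
move=> [m _ fu] [n _ fv].
have [Eu cu] := Ftilde_n_le (leq_maxl m n) fu.
have [Ev cv] := Ftilde_n_le (leq_maxr m n) fv.
apply: (@Ftilde_n_flat (maxn m n)); split; first exact: (psd_lin psdE).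
by move=> a Aa x y Kx Ky; rewrite !funE (cu a Aa x y)// (cv a Aa x y).
Qed.

Lemma flat_clip u : flat u -> flat (clip u).
Proof.
move=> [n n1 [Eu cu]]; exists n => //; split; first exact: (clip_E fr hs Eu).1.
by move=> a Aa x y Kx Ky; rewrite /clip (cu a Aa x y).
Qed.

Lemma psd_flat (f : qform R T) : psd_form f -> flat `<=` dom f ->
  psd_form (subform f flat).
Proof.
move=> pf ff; split=> /=.
- exact: flat_cst.
- exact: flat_lin.
- by move=> u v /ff fu /ff fv; exact: (psd_sym pf).
- by move=> k u v w /ff fu /ff fv /ff fw; exact: (psd_bilin pf).
- by move=> u /ff; exact: (psd_ge0 pf).
- exact: (psd_cst0 pf).
Qed.

Lemma clip_flat (f : qform R T) : clip_closed f -> flat `<=` dom f ->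
  clip_closed (subform f flat).
Proof.
by move=> cf ff u fu; split; [exact: flat_clip|exact: (cf u (ff u fu)).2].
Qed.

(** Pointwise convergence costs nothing in the definition of [Ftilde]: it can
    be enforced at one point by adding constants, and then it follows from the
    bound of increments by energy. *)
Lemma FtildeP u : Ft u <->
  dom E u /\ forall e : R, 0 < e ->
    exists2 w, flat w & en E (u - w) (u - w) <= e.
Proof.
split=> [[Eu [w [fw wu _]]]|[Eu happ]].
  split=> // e e0; have [N hN] := cvg0_le wu e0.
  by exists (w N); [exact: fw|exact: hN].
split=> //; have [x0 _] := Vn_point fr 0.
have /choice[w wP] (k : nat) : exists w, [/\ flat w, w x0 = u x0 &
    en E (u - w) (u - w) <= k.+1%:R^-1].
  have [|w fw wQ] := happ k.+1%:R^-1; first by rewrite invr_gt0.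
  exists (w + (fun=> u x0 - w x0)); split.
  - by rewrite -[w]scale1r; apply: flat_lin => //; exact: flat_cst.
  - by rewrite addfE addrC subrK.
  - have -> : u - (w + (fun=> u x0 - w x0)) = u - w + (fun=> - (u x0 - w x0)).
      by apply/funext => x; rewrite !funE; ring.
    by rewrite (en_addcst psdE _ (domB psdE Eu (flat_dom fw))).
have wQ : en E (u - w k) (u - w k) @[k --> \oo] --> (0 : R).
  apply: (squeeze_cvgr (f := fun=> 0) (h := fun k => k.+1%:R^-1)).
  - apply: nearW => k; have [fw _ ->] := wP k; rewrite andbT.
    exact: (psd_ge0 psdE (domB psdE Eu (flat_dom fw))).
  - exact: cvg_cst.
  - exact: cvg_harmonic.
exists w; split=> //; first by move=> k; have [] := wP k.
move=> x; have [C hC] := E_point_bounded fr hs x x0.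
apply/cvgrPdist_le => e e0.
have C1 : 0 < `|C| + 1 by rewrite ltr_wpDl.
have d0 : 0 < e ^+ 2 / (`|C| + 1) by rewrite divr_gt0 ?exprn_gt0.
have [N hN] := cvg0_le wQ d0; exists N => // k Nk /=.
have [fw wx0 _] := wP k; have Euw := domB psdE Eu (flat_dom fw).
have := hN k Nk; rewrite ler_pdivlMr// => h.
have Q0 := psd_ge0 psdE Euw.
rewrite -ler_sqr ?nnegrE ?(ltW e0)// real_normK ?num_real//.
have := hC _ Euw; rewrite !funE wx0 subrr subr0 => /le_trans; apply.
apply: le_trans h; rewrite mulrC ler_wpM2l//.
by have := ler_norm C; lra.
Qed.

Lemma flat_Ftilde : flat `<=` Ft.
Proof.
move=> u fu; apply/FtildeP; split; first exact: flat_dom.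
by move=> e e0; exists u; rewrite // subrr (en0l psdE) ?ltW//; exact: (dom0 psdE).
Qed.

Lemma Ftilde_dom : Ft `<=` dom E.
Proof. by move=> u []. Qed.

Lemma psd_Etilde : psd_form (Etilde_form S At).
Proof.
split=> /=.
- by move=> c; exact/flat_Ftilde/flat_cst.
- move=> k u v /FtildeP[Eu hu] /FtildeP[Ev hv]; apply/FtildeP.
  split=> [|e e0]; first exact: (psd_lin psdE).
  have k1 : 0 < 4 * (k ^+ 2 + 1) by rewrite mulr_gt0// ltr_wpDl// sqr_ge0.
  have [|u' fu' uu'] := hu (e / (4 * (k ^+ 2 + 1))); first by rewrite divr_gt0.
  have [|v' fv' vv'] := hv (e / 4); first by rewrite divr_gt0.
  exists (k *: u' + v'); first exact: flat_lin.
  have Eu' := domB psdE Eu (flat_dom fu'); have Ev' := domB psdE Ev (flat_dom fv').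
  have -> : k *: u + v - (k *: u' + v') = k *: (u - u') + (v - v').
    by apply/funext => x; rewrite !funE; ring.
  rewrite (le_trans (en_add_le2 psdE (domZ psdE k Eu') Ev'))// (en_scale psdE)//.
  move: uu'; rewrite ler_pdivlMr// => uu'.
  have := psd_ge0 psdE Eu'; have := sqr_ge0 k; nra.
- by move=> u v /Ftilde_dom fu /Ftilde_dom fv; exact: (psd_sym psdE).
- move=> k u v w /Ftilde_dom fu /Ftilde_dom fv /Ftilde_dom fw.
  exact: (psd_bilin psdE).
- by move=> u /Ftilde_dom; exact: (psd_ge0 psdE).
- exact: (psd_cst0 psdE).
Qed.

Lemma Etilde_complete : complete_form (Etilde_form S At).
Proof.
move=> u fu cau.
have [v Ev uv] := E_complete fr hs (fun n => Ftilde_dom (fu n)) cau.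
exists v => //; apply/FtildeP; split=> // e e0.
have e40 : 0 < e / 4 by rewrite divr_gt0.
have [N /(_ N (leqnn N)) h] := cvg0_le uv e40.
have /FtildeP[EN /(_ _ e40)[w fw wQ]] := fu N.
exists w => //.
have -> : v - w = (v - u N) + (u N - w) by rewrite addrA subrK.
have := en_add_le2 psdE (domB psdE Ev EN) (domB psdE EN (flat_dom fw)).
rewrite (en_subC psdE Ev EN) => /le_trans; apply; lra.
Qed.

Lemma Etilde_point_bounded : point_bounded (Etilde_form S At).
Proof.
move=> x y; have [C hC] := E_point_bounded fr hs x y.
by exists C => u /Ftilde_dom; exact: hC.
Qed.

(** What each of the statements on traces and on resistances provides, and from
    which the density of [Ftilde] follows. *)
Definition nearly_extremal := forall n u (e : R), dom E u -> 0 < e -> exists w,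
  [/\ Ft w, forall x, Vn S n x -> w x = u x & en E w w <= en E u u + e].

(** Two functions with the same values on [Vn n], whose energies are both close
    to the least possible one, are close in energy by the parallelogram
    identity. *)
Lemma nearly_extremal_dense : nearly_extremal -> dom E = Ft.
Proof.
move=> star; apply/seteqP; split=> u; last exact: Ftilde_dom.
move=> Eu; apply/FtildeP; split=> // e e0.
have e160 : 0 < e / 16 by rewrite divr_gt0.
have [n /(_ n (leqnn n)) un] := cvg_close (level_cvg_E fr hs Eu) e160.
have [w [fw wu wQ]] := star n u _ Eu e160; have Ew := Ftilde_dom fw.
have /FtildeP[_ /(_ _ e160)[w' fw' wQ']] := fw.
exists w' => //.
have -> : u - w' = (u - w) + (w - w') by rewrite addrA subrK.
have := en_add_le2 psdE (domB psdE Eu Ew) (domB psdE Ew (flat_dom fw')).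
move=> /le_trans; apply; rewrite (parallelogram psdE)//.
have := level_le_E fr hs n (domD psdE Eu Ew).
have -> : level_en S n (u + w) (u + w) = 4 * level_en S n u u.
  transitivity (level_en S n (2 *: u) (2 *: u)).
    have e2 x : Vn S n x -> (u + w) x = (2 *: u) x.
      by move=> Vx; rewrite !funE wu//; ring.
    exact: level_en_local.
  by have /= -> := @en_scale _ _ _ (psd_level fr n) 2 u I; rewrite -natrX.
move: un wQ wQ'; rewrite ler_norml => /andP[_].
lra.
Qed.

Lemma dense_eq : dom E = Ft -> Etilde_form S At = E.
Proof. by rewrite /Etilde_form /subform => <-. Qed.

End Tilde.

(** * Comparison of the forms *)

Section Comparison.
Variables (R : realType) (T A : choiceType) (S : cell_structure R T A).
Variable At : nat -> set A.
Hypotheses (fr : finitely_ramified S) (hs : harmonic_structure S).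
Hypothesis A1 : assumption_A1 S At.
Local Notation K := (K_ S).
Local Notation V := (V_ S).
Local Notation F := (filt S).
Local Notation E := (E_form S).
Local Notation Et := (Etilde_form S At).
Local Notation Ft := (Ftilde S At).
Local Notation flat := (flat S At).
Local Notation psdE := (psd_E fr hs).
Implicit Types (a b : A) (u v w : T -> R).

(** [Ftilde] is complete, hence both traces are attained, and the minimal
    extension in [Ftilde] has the energy of the minimal extension in the whole
    domain. *)
Lemma traces_nearly_extremal :
  (forall n, eq_form (trace_form (sigL (Vn S n)) E)
                     (trace_form (sigL (Vn S n)) Et)) -> nearly_extremal S At.
Proof.
move=> tr n u e Eu e0; have [domE enE] := tr n.
have [x0 Vx0] := Vn_point fr n; pose y0 : Vn S n := SigSub (mem_set Vx0).
have du : dom (trace_form (sigL (Vn S n)) E) (sigL (Vn S n) u) by exists u.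
have [u' fu' u'u] : (sigL (Vn S n) @` Ft) (sigL (Vn S n) u).
  by move: du; rewrite domE.
have [v [fv vu' vE _]] := trace_form_min set_val (psd_Etilde fr hs A1) y0
  (Etilde_complete fr hs A1) (Etilde_point_bounded At fr hs) fu'.
have [w [Ew _ wE wmin]] := trace_form_min set_val psdE y0
  (E_complete fr hs) (E_point_bounded fr hs) Eu.
exists v; split=> //.
  move=> x Vx; have := congr1 (@^~ (SigSub (mem_set Vx))) vu'.
  by have /= -> := congr1 (@^~ (SigSub (mem_set Vx))) u'u.
have -> : en E v v = en E w w.
  by rewrite [RHS]wE [LHS]vE; have := enE _ _ du du; rewrite -{3 4}u'u => /esym.
by rewrite (le_trans (wmin u Eu erefl))// lerDl ltW.
Qed.

Lemma resistance_mono (f : qform R T) (W W' : set (T -> R)) x y : W `<=` W' ->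
  (resistance (subform f W) x y <= resistance (subform f W') x y)%E.
Proof.
move=> WW'; apply: resistance_le; first exact: resistance_ge0.
move=> u /= Wu u0; apply: (@resistance_ub _ _ (subform f W') u x y) => //.
exact: WW'.
Qed.

Lemma subform_dom (X : Type) (f : qform R X) : subform f (dom f) = f.
Proof. by case: f. Qed.

Lemma Rtilde_flat x y : Rtilde S At x y = resistance (subform E flat) x y.
Proof.
have cv : Rtilde_n S At n x y @[n --> \oo] -->
    ereal_sup (range (fun n => Rtilde_n S At n x y)).
  apply: ereal_nondecreasing_cvgn => m n mn; apply: resistance_mono => u.
  exact: Ftilde_n_le.
rewrite /Rtilde (cvg_lim _ cv)//; apply/eqP; rewrite eq_le; apply/andP; split.
  apply: ge_ereal_sup => _ [n _ <-]; apply: resistance_mono => u.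
  exact: Ftilde_n_flat.
apply: resistance_le.
  apply: (le_trans (resistance_ge0 (subform E (Ftilde_n S At 0)) x y)).
  by apply: ereal_sup_ubound; exists 0%N.
move=> u /= [n _ fu] u0.
apply: (le_trans (@resistance_ub _ _ (subform E (Ftilde_n S At n)) u x y fu u0)).
by apply: ereal_sup_ubound; exists n.
Qed.

Lemma finite_Vn n : finite_set (Vn S n).
Proof.
by apply: bigcup_finite; [exact: (frc_f_fin fr)|move=> a _; exact: (frc_c_fin fr)].
Qed.

Lemma points_separated n x y : Vn S n x -> Vn S n y -> x != y ->
  exists2 h, dom E h & h x != h y.
Proof.
move=> Vx Vy xy; have [h [Eh hE]] := energy_extension fr hs n (point_mass R x).
exists h => //; rewrite !hE// /point_mass eqxx [y == x]eq_sym (negbTE xy).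
by rewrite oner_eq0.
Qed.

Lemma resistances_nearly_extremal :
  (forall x y, resistance E x y = Rtilde S At x y) -> nearly_extremal S At.
Proof.
move=> res n u e Eu e0; have finV := finite_Vn n.
have [x0 [y0 [Vx0 Vy0 xy0]]] := frc_c_two fr (Defs.root S).
have Vn0 x : V (Defs.root S) x -> Vn S n x.
  move=> Vx; apply: (Vn_le fr (leq0n n)); exists (Defs.root S) => //.
  by rewrite (frc_f0 fr).
have [z Ez /eqP zxy] := points_separated (Vn0 _ Vx0) (Vn0 _ Vy0) (introN eqP xy0).
have zgt := E_gt0 fr hs Ez zxy.
have inV x : x \in enum_fset (fset_set (Vn S n)) -> Vn S n x.
  by rewrite in_fset_set// inE.
have [x y /inV Vx /inV Vy|x y _ _|w [fw wu wQ]] := interpolation psdE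
  (psd_flat fr hs A1 psdE (@flat_dom _ _ _ S At)) (@flat_dom _ _ _ S At)
  (clip_flat fr hs (clip_E fr hs) (@flat_dom _ _ _ S At))
  (fset_uniq (fset_set (Vn S n))) Ez zgt _ _ Eu e0.
- exact: points_separated Vx Vy.
- by rewrite res Rtilde_flat.
exists w; split=> //; first exact: (flat_Ftilde fr hs A1).
by move=> x Vx; apply: wu; rewrite in_fset_set// inE.
Qed.

Lemma resistance_sigL a (f : qform R T) (g : qform R (K a)) :
    dom g = sigL (K a) @` dom f ->
    (forall u, dom f u -> en g (sigL (K a) u) (sigL (K a) u) = en f u u) ->
  forall x y, resistance g x y = resistance f (set_val x) (set_val y).
Proof.
move=> gf enE x y; rewrite /resistance; congr (maxe _ (ereal_sup _)).
apply/seteqP; split=> _ [u [du u0] <-].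
  move: du u0; rewrite gf => -[v fv <-]; rewrite enE// => v0.
  by exists v.
exists (sigL (K a) u); last by rewrite enE.
by split; [rewrite gf; exists u|rewrite enE].
Qed.

Lemma EKn_sub a n u v :
  EKn n (sigL (K a) u) (sigL (K a) v) = sub_en S a n u v.
Proof.
apply: eq_fsbigr => b /set_mem[Fb Kba].
apply: cell_en_local => x /(V_sub_K fr)/Kba Kx;
  by rewrite -[LHS]/(('valL_0 \o sigL (K a)) _ x) sigLK patchT// mem_set.
Qed.

Lemma EK_sigL a u v :
  en (EK_form S a) (sigL (K a) u) (sigL (K a) v) = en (cell_form S a) u v.
Proof. by rewrite /=; congr (limn _); apply/funext => n; exact: EKn_sub. Qed.

Lemma dom_EK_sigL a u :
  dom (EK_form S a) (sigL (K a) u) = dom (cell_form S a) u.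
Proof.
rewrite /=; congr (limn _ < _)%E; apply/funext => n; congr EFin.
exact: EKn_sub.
Qed.

Lemma dom_EK a : dom (EK_form S a) = sigL (K a) @` dom (cell_form S a).
Proof.
apply/seteqP; split=> u; last by move=> [v dv <-]; rewrite dom_EK_sigL.
by rewrite -[u](valLK 0) dom_EK_sigL => du; exists ('valL_0 u).
Qed.

Lemma dense_EK a : dom E = Ft -> dom (EK_form S a) = sigL (K a) @` Ft.
Proof.
move=> EF; rewrite dom_EK -EF; apply/seteqP; split=> _ [u du <-].
  have [w Ew wu] := cell_extension fr hs du; exists w => //.
  by apply/funext => x; apply: wu; exact: set_valP.
by exists u => //; exact: dom_cell_form.
Qed.

Lemma EKtilde_eq a : dom (EK_form S a) = sigL (K a) @` Ft ->
  EKtilde_form S At a = EK_form S a.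
Proof. by rewrite /EKtilde_form /subform => <-. Qed.

Lemma flat_cell_dom a : flat `<=` dom (cell_form S a).
Proof. by move=> u /flat_dom; exact: dom_cell_form. Qed.

Lemma resistance_EKtilde a (x y : K a) :
  resistance (EKtilde_form S At a) x y =
  resistance (subform (cell_form S a) flat) (set_val x) (set_val y).
Proof.
rewrite (@resistance_sigL a (subform (cell_form S a) Ft))//; last first.
  by move=> u _; exact: EK_sigL.
have flatFt := flat_Ftilde fr hs A1.
have Ft_cell : Ft `<=` dom (cell_form S a).
  by move=> u /Ftilde_dom; exact: dom_cell_form.
apply/eqP; rewrite eq_le; apply/andP; split; last exact: resistance_mono.
apply: (resistance_dense _ _ (psd_cell_form fr hs a)) => //.
  exact: flat_cell_dom.
move=> u [Eu [w [fw wu wpt]]]; exists w; split=> //.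
have Ew k : dom E (w k) := flat_dom (fw k).
have psda := psd_cell_form fr hs a.
apply: (squeeze_cvgr (f := fun=> 0) (h := fun k => en E (u - w k) (u - w k))).
- apply: nearW => k; apply/andP; split.
    by apply: (psd_ge0 psda); apply: dom_cell_form => //; exact: (domB psdE).
  by rewrite (en_subC psdE Eu (Ew k)) cell_form_le//; exact: (domB psdE).
- exact: cvg_cst.
- exact: wu.
Qed.

(** Different cells of one level meet only in common vertices, so that agreement
    on vertices suffices for gluing; a marked cell of a deeper level lies in one
    of the cells, hence the glued function is constant on it. *)
Lemma flat_glue n u (w : A -> T -> R) :
    (forall a, F n a -> flat (w a)) ->
    (forall a x, F n a -> V a x -> w a x = u x) ->
  exists g, [/\ flat g, forall x, Vn S n x -> g x = u x &
    en E g g = \sum_(a \in F n) en (cell_form S a) (w a) (w a)].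
Proof.
move=> fw wu.
have /choice[c cP] x : exists a, F n a /\ K a x.
  by have [a Fa Kx] := level_cover fr n x; exists a.
pose g x := w (c x) x.
have gE a x : F n a -> K a x -> g x = w a x.
  move=> Fa Kx; have [Fc Kc] := cP x; rewrite /g.
  have [<-//|ca] := pselect (c x = a).
  by have [Vc Va] := K_cap_V fr Fc Fa ca Kc Kx; rewrite !wu.
have gw a : F n a -> (dom (cell_form S a) (w a) -> dom (cell_form S a) g) /\
    en (cell_form S a) (w a) (w a) = en (cell_form S a) g g.
  by move=> Fa; apply: (cell_form_local fr) => x Kx; rewrite (gE a).
have Eg : dom E g.
  apply: (glue_dom fr hs (m := n)) => a Fa; apply: (gw a Fa).1.
  exact/flat_cell_dom/fw.
exists g; split.
- have /choice[k kP] (a : A) : exists k, F n a -> Ftilde_n S At k (w a).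
    have [Fa|nFa] := pselect (F n a); last by exists 0%N.
    by have [k _ fk] := fw a Fa; exists k.
  have [M hM] := finite_nat_bound k (frc_f_fin fr n).
  apply: (Ftilde_n_flat A1 (n := maxn n M)); split=> // b Ab x y Kx Ky.
  have [Fb _ _] := A1; have [a Fa Kba] := ancestor fr (leq_maxl n M) (Fb _ _ Ab).
  rewrite !(gE a)//; try exact: Kba.
  have [_ cw] := Ftilde_n_le A1 (leq_trans (hM a Fa) (leq_maxr n M)) (kP a Fa).
  exact: cw Ab _ _ Kx Ky.
- move=> x [a Fa Vx]; rewrite (gE a)// ?wu//; exact: (V_sub_K fr).
- rewrite (E_sum_cells fr hs n Eg); apply: eq_fsbigr => a /set_mem Fa.
  by rewrite (gw a Fa).2.
Qed.

(** Interpolation in each cell of level [n] with the values on its vertices,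
    then gluing. The interpolating functions are taken in [flat] and not only in
    [Ftilde], because gluing keeps [flat]. *)
Lemma cell_resistances_nearly_extremal :
  (forall a (x y : K a), V a (set_val x) -> V a (set_val y) ->
     resistance (EK_form S a) x y = resistance (EKtilde_form S At a) x y) ->
  nearly_extremal S At.
Proof.
move=> res n u e Eu e0.
pose M : R := (size (fset_set (F n)))%:R.
have M1 : 0 < M + 1 by rewrite ltr_wpDl// /M.
have d0 : 0 < e / (M + 1) by rewrite divr_gt0.
have /choice[w wP] (a : A) : exists w, F n a -> [/\ flat w,
    forall x, V a x -> w x = u x &
    en (cell_form S a) w w <= en (cell_form S a) u u + e / (M + 1)].
  have [Fa|nFa] := pselect (F n a); last by exists 0.
  have finV := frc_c_fin fr a.
  have [z dz zgt] := cell_form_gt0 fr hs a.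
  have inV x : x \in enum_fset (fset_set (V a)) -> V a x.
    by rewrite in_fset_set// inE.
  have VVn x : V a x -> Vn S n x by exists a.
  have VK x : V a x -> K a x by exact: (V_sub_K fr).
  have [x y /inV Vx /inV Vy xy|x y /inV Vx /inV Vy|w [fw wu wQ]] :=
      interpolation (psd_cell_form fr hs a)
      (psd_flat fr hs A1 (psd_cell_form fr hs a) (@flat_cell_dom a))
      (@flat_cell_dom a)
      (clip_flat fr hs (@clip_cell_form _ _ _ S fr hs a) (@flat_cell_dom a))
      (fset_uniq (fset_set (V a))) dz zgt _ _ (dom_cell_form fr hs a Eu) d0.
  - have [h Eh hxy] := points_separated (VVn _ Vx) (VVn _ Vy) xy.
    by exists h => //; exact: dom_cell_form.
  - have := res a (SigSub (mem_set (VK _ Vx))) (SigSub (mem_set (VK _ Vy))) Vx Vy.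
    rewrite resistance_EKtilde (@resistance_sigL a (cell_form S a))//.
      exact: dom_EK.
    by move=> v _; exact: EK_sigL.
  exists w => _; split=> //.
  by move=> x Vx; apply: wu; rewrite in_fset_set// inE.
have [g [fg gu gE]] := flat_glue (fun a Fa => let: And3 h _ _ := wP a Fa in h)
  (fun a x Fa => let: And3 _ h _ := wP a Fa in h x).
exists g; split=> //; first exact: (flat_Ftilde fr hs A1).
rewrite gE (E_sum_cells fr hs n Eu).
apply: (@le_trans _ _ (\sum_(a \in F n) (en (cell_form S a) u u + e / (M + 1)))).
  by apply: ler_fsum_set (frc_f_fin fr n) _ => a Fa; have [] := wP a Fa.
rewrite !(fsbig_finite _ _ (frc_f_fin fr n)) /= big_split /= lerD2l.
rewrite big_const_seq count_predT iter_addr_0 -mulr_natl -/M.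
by rewrite mulrA ler_pdivrMr// mulrC ler_wpM2l// ?(ltW e0)// lerDl.
Qed.

Lemma dense_resistance x y : dom E = Ft -> resistance E x y = Rtilde S At x y.
Proof.
move=> EF; rewrite Rtilde_flat; apply/eqP; rewrite eq_le; apply/andP; split.
  rewrite -{1}(subform_dom E) EF.
  apply: (resistance_dense _ _ psdE); first exact: flat_dom.
    exact: Ftilde_dom.
  move=> u [Eu [w [fw wu wpt]]]; exists w; split=> //.
  have -> : (fun k => en E (w k - u) (w k - u)) =
      (fun k => en E (u - w k) (u - w k)).
    by apply/funext => k; rewrite (en_subC psdE)//; exact: flat_dom (fw k).
  exact: wu.
by rewrite -{2}(subform_dom E); apply: resistance_mono; exact: flat_dom.
Qed.

End Comparison.

Theorem theorem4p8 (R : realType) (T A : choiceType)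
    (S : cell_structure R T A) (At : nat -> set A) :
  finitely_ramified S -> harmonic_structure S -> assumption_A1 S At -> assumption_A2 S ->
  [<-> (* 1 *) eq_form (E_form S) (Etilde_form S At) ;
       (* 2 *) forall n, eq_form (trace_form (sigL (Vn S n)) (E_form S))
                                 (trace_form (sigL (Vn S n)) (Etilde_form S At)) ;
       (* 3 *) forall a, eq_form (EK_form S a) (EKtilde_form S At a) ;
       (* 4 *) forall a (x y : K_ S a), V_ S a (set_val x) -> V_ S a (set_val y) ->
                 resistance (EK_form S a) x y = resistance (EKtilde_form S At a) x y ;
       (* 5 *) forall x y : T, resistance (E_form S) x y = Rtilde S At x y].
Proof.
move=> fr hs A1 _.
split; [|split; [|split; [|split]]].
- by case=> /dense_eq-> _ n.
- move=> /(traces_nearly_extremal fr hs A1).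
  move=> /(nearly_extremal_dense fr hs A1) EF a.
  by rewrite (EKtilde_eq (dense_EK fr hs a EF)).
- by move=> h a x y _ _; rewrite (EKtilde_eq (h a).1).
- move=> /(cell_resistances_nearly_extremal fr hs A1).
  move=> /(nearly_extremal_dense fr hs A1) EF x y.
  exact: dense_resistance.
- move=> /(resistances_nearly_extremal fr hs A1).
  move=> /(nearly_extremal_dense fr hs A1) EF.
  by rewrite (dense_eq EF).
Qed.
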